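(* Let $\mathbf{B}_4=\langle\sigma_1,\sigma_2,\sigma_3\mid \sigma_1\sigma_2\sigma_1=\sigma_2\sigma_1\sigma_2,\ \sigma_2\sigma_3\sigma_2=\sigma_3\sigma_2\sigma_3,\ \sigma_1\sigma_3=\sigma_3\sigma_1\rangle$ and $\gamma_0=\sigma_2^2\sigma_3^2\sigma_2^{-2}\sigma_3^{-2}\in\mathbf{B}_4$. Then: (i) there is a fixed finite subset $X\subseteq\mathbf{B}_4$ such that membership in $\mathrm{Mon}(X)$ is undecidable; in particular the submonoid membership problem for $\mathbf{B}_4$ is undecidable; (ii) there is no algorithm which, given a finite set $X\subseteq\mathbf{B}_4$, decides whether $\gamma_0\in\mathrm{Mon}(X)$; (iii) there is no algorithm which, given a finite set $X\subseteq\mathbf{B}_4$, decides whether $\mathrm{Sgp}(X)\cap\mathrm{Sgp}(\gamma_0)=\varnothing$; in particular the subsemigroup intersection problem in $\mathbf{B}_4$ is undecidable.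
   Context: $\mathrm{Mon}(X)$ and $\mathrm{Sgp}(X)$ denote the submonoid and subsemigroup generated by $X$; elements are given as words over the generators and their inverses. *)

(* Defs.v *)
From mathcomp Require Import all_boot.
Set Warnings "-notation-overridden".
Set Implicit Arguments. Unset Strict Implicit. Unset Printing Implicit Defensive.

(* Model of computation: Minsky register machines (Turing complete).   *)

Inductive instr : Type :=
| INC of nat
| DEC of nat & nat.

Definition program := seq instr.
Definition rstate : Type := (nat * (nat -> nat))%type.

Definition upd (f : nat -> nat) (r v : nat) : nat -> nat :=
  fun k => if k == r then v else f k.

Definition rm_step (P : program) (s : rstate) : rstate :=
  let: (pc, regs) := s in
  if size P <= pc then s else
  match nth (INC 0) P pc with
  | INC r => (pc.+1, upd regs r (regs r).+1)
  | DEC r j =>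
      if regs r == 0 then (j, regs) else (pc.+1, upd regs r (regs r).-1)
  end.

Definition rm_exec (P : program) (k : nat) (s : rstate) : rstate :=
  iter k (rm_step P) s.

Definition rm_init (n : nat) : rstate := (0, fun r => if r == 0 then n else 0).

Definition rm_halts_with (P : program) (n m : nat) : Prop :=
  exists k, let s := rm_exec P k (rm_init n) in
            size P <= s.1 /\ s.2 0 = m.

Definition RM_decidable (A : Type) (enc : A -> nat) (Q : A -> Prop) : Prop :=
  exists P : program, forall a : A,
    (Q a -> rm_halts_with P (enc a) 1) /\ (~ Q a -> rm_halts_with P (enc a) 0).

(* Encodings of instances as natural numbers (Cantor pairing).          *)

Definition cpair (x y : nat) : nat := ((x + y) * (x + y).+1) %/ 2 + y.

Definition enc_seq (A : Type) (e : A -> nat) (s : seq A) : nat :=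
  foldr (fun a acc => (cpair (e a) acc).+1) 0 s.

(* A letter (i, b) is sigma_(i+1) if b = false, its inverse if b = true. *)

Definition letter := ('I_3 * bool)%type.
Definition word := seq letter.

Definition enc_letter (a : letter) : nat := (nat_of_ord a.1).*2 + a.2.
Definition enc_word (w : word) : nat := enc_seq enc_letter w.
Definition enc_words (X : seq word) : nat := enc_seq enc_word X.
Definition enc_words_word (p : seq word * word) : nat :=
  cpair (enc_words p.1) (enc_word p.2).
Definition enc_words_words (p : seq word * seq word) : nat :=
  cpair (enc_words p.1) (enc_words p.2).

Definition linv (a : letter) : letter := (a.1, ~~ a.2).

Definition sig (i : nat) : letter := (inord i, false).
Definition sigi (i : nat) : letter := (inord i, true).

Inductive beq : word -> word -> Prop :=
| beq_refl w : beq w w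
| beq_sym w w' : beq w w' -> beq w' w
| beq_trans w1 w2 w3 : beq w1 w2 -> beq w2 w3 -> beq w1 w3
| beq_ctx u v w w' : beq w w' -> beq (u ++ w ++ v) (u ++ w' ++ v)
| beq_cancel a : beq [:: a; linv a] [::]
| beq_rel12 : beq [:: sig 0; sig 1; sig 0] [:: sig 1; sig 0; sig 1]
| beq_rel23 : beq [:: sig 1; sig 2; sig 1] [:: sig 2; sig 1; sig 2]
| beq_rel13 : beq [:: sig 0; sig 2] [:: sig 2; sig 0].

Definition gamma0 : word :=
  [:: sig 1; sig 1; sig 2; sig 2; sigi 1; sigi 1; sigi 2; sigi 2].

Definition inMon (X : seq word) (w : word) : Prop :=
  exists l : seq word, all (fun x => x \in X) l /\ beq (flatten l) w.

Definition inSgp (X : seq word) (w : word) : Prop :=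
  exists l : seq word, l != [::] /\ all (fun x => x \in X) l /\ beq (flatten l) w.

Definition sgp_disjoint (X Y : seq word) : Prop :=
  ~ (exists w : word, inSgp X w /\ inSgp Y w).

(* Main.v *)
(** The braids [a = s2^2], [b = (s1 s2)^6], [c = s1^2], [d = s3^2] satisfy [ab = ba], [bc = cb], [cd = dc], and [gamma0 = [a, d]]. Powers of [c] and [b] (below, of [c^6] and [b^3]) serve as counters separated by the blocks [a^3] and [d^3]: a transition [q k + r |-> p k + s] of a one-counter machine is executed by multiplying with [c^-r b^s] once and with [c^-q b^p] repeatedly, then with [a^3] (past which [b] may move), then with [b^-1 c], then with [d^3] (past which [c] may move). If every counter was exhausted when its block was closed, the result is [(a^3 d^3)^T], which is finally cancelled; the control flow is enforced by conjugating a transition from [p] to [q] into [h_p u h_q^-1] for suitable words [h_p] in [a] and [d].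

For the converse two homomorphisms into a free group on [s, t] (in fact into [SL_2(Z)]) suffice: [psi_1] comes from the resolvent map [B_4 -> B_3] and sends [a, b, c, d] to [s, 1, t, t]; [psi_2] forgets the first strand and sends them to [s, s^2, 1, t]. If a product of generators equals a power of [gamma0], normal forms under [psi_1] show that the transitions match up, and the normal forms under [psi_1] and [psi_2] show that all counters vanish, hence that the machine halts.

Register machines become such counter machines by Goedel numbering, a universal one interprets Goedelized programs, and a diagonal argument shows that its halting set is undecidable. *)

Require Import Defs.
From Stdlib Require Import Setoid Morphisms FunctionalExtensionality Classical.
From mathcomp Require Import all_boot all_algebra zify ring.
Set Implicit Arguments. Unset Strict Implicit. Unset Printing Implicit Defensive.
Import GRing.Theory Num.Theory.

(** * Normal forms in a free group of rank two *)

Section FreeNormalForms.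
Local Open Scope ring_scope.

(** The obstacle is that an arbitrary product of generators need not respect the control flow, so
    cancellation has to be read off from residues of syllable exponents. Key exponents are prime to
    3, while in either image every content exponent is a multiple of 3, so content alone never
    cancels a key syllable. Since [psi_2] sends [b] to [s^2], the counter units [c^6] and [b^3] both
    have exponent 6 in the image that sees them, whereas a separator has exponent 3: a counter that
    merges with a separator yields [6 z + 3], which never vanishes and equals 3 only if the counter
    is exhausted. [psi_1] is blind to [b] and [psi_2] to [c], hence both are needed. The remaining
    danger is a closed walk with trivial image, which would let [h_p] meet its own inverse; exponent
    sums under [psi_1] exclude it. The key of the start state is [gamma0] itself and that of the
    stop state is empty, so one complete run contributes exactly one factor [gamma0]. *)

Definition vec := (int * int)%type.

(* The syllables [(true, e)] and [(false, e)] stand for the powers [s^e] and [t^e] of Sanov's free generators of a subgroup of [SL_2(Z)]. *)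
Definition syll := (bool * int)%type.

(** The sign in [Vmap] makes [Umap 1] and [Vmap 1] satisfy the braid relation, so the same maps
    carry the braid action; the doubled exponents in [syll_act] give Sanov's free subgroup. *)
Definition Umap (e : int) (v : vec) : vec := (v.1 + e * v.2, v.2).
Definition Vmap (e : int) (v : vec) : vec := (v.1, v.2 - e * v.1).

Definition syll_act (x : syll) (v : vec) : vec :=
  if x.1 then Vmap (2 * x.2) v else Umap (2 * x.2) v.

Definition sylls_act (l : seq syll) (v : vec) : vec := foldr syll_act v l.

(** Left multiplication of a normal form by one power. When two syllables cancel, no further merging
    can follow, because neighbouring letters alternate. *)
Definition push (x : syll) (l : seq syll) : seq syll :=
  if x.2 == 0 then l else
  if l is y :: l' then
    if x.1 == y.1 then if x.2 + y.2 == 0 then l' else (x.1, x.2 + y.2) :: l'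
    else x :: l
  else [:: x].

Definition pushs (l r : seq syll) : seq syll := foldr push r l.
Definition reduce (l : seq syll) : seq syll := pushs l [::].

Fixpoint reduced (l : seq syll) : bool :=
  if l is x :: l' then
    [&& x.2 != 0, (if l' is y :: _ then x.1 != y.1 else true) & reduced l']
  else true.

Lemma syll_actD b e f v :
  syll_act (b, e + f) v = syll_act (b, e) (syll_act (b, f) v).
Proof. by case: v => x y; case: b; rewrite /syll_act /Umap /Vmap /=; congr pair; ring. Qed.

Lemma syll_act0 b v : syll_act (b, 0) v = v.
Proof. by case: v => x y; case: b; rewrite /syll_act /Umap /Vmap /=; congr pair; ring. Qed.

Lemma sylls_act_cat l r v : sylls_act (l ++ r) v = sylls_act l (sylls_act r v).
Proof. exact: foldr_cat. Qed.

Lemma push_act x l v : sylls_act (push x l) v = syll_act x (sylls_act l v).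
Proof.
case: x => b e; rewrite /push /=; case: eqP => [->|_]; first by rewrite syll_act0.
case: l => [|[b' e'] l] //=; case: eqP => [<-|_] //.
by rewrite -syll_actD; case: eqP => [->|_] //=; rewrite syll_act0.
Qed.

Lemma pushs_act l r v : sylls_act (pushs l r) v = sylls_act (l ++ r) v.
Proof. by elim: l => //= x l IH; rewrite push_act IH. Qed.

Lemma reduce_act l v : sylls_act (reduce l) v = sylls_act l v.
Proof. by rewrite pushs_act cats0. Qed.

Lemma reduced_behead x l : reduced (x :: l) -> reduced l.
Proof. by case/and3P. Qed.

Lemma push_reduced x l : reduced l -> reduced (push x l).
Proof.
case: x => b e; rewrite /push /=; case: eqP => // /eqP e0.
case: l => [|[b' e'] l] /=; first by rewrite e0.
case/and3P => e'0 hl rl; case: eqP => [E|/eqP ne].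
  case: eqP => // /eqP ee; apply/and3P; split=> //; by rewrite E.
by rewrite /= e0 ne e'0 hl rl.
Qed.

Lemma pushs_reduced l r : reduced r -> reduced (pushs l r).
Proof. by move=> rr; elim: l => //= x l; apply: push_reduced. Qed.

Lemma reduce_reduced l : reduced (reduce l).
Proof. exact: pushs_reduced. Qed.

Definition steep (v : vec) : bool := `|v.1| < `|v.2|.
Definition flat (v : vec) : bool := `|v.2| < `|v.1|.

Lemma syll_act_steep e v : e != 0 -> flat v -> steep (syll_act (true, e) v).
Proof. rewrite /steep /flat /syll_act /Vmap /=; case: v => x y /= e0 h; nia. Qed.

Lemma syll_act_flat e v : e != 0 -> steep v -> flat (syll_act (false, e) v).
Proof. rewrite /steep /flat /syll_act /Umap /=; case: v => x y /= e0 h; nia. Qed.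

Lemma steep_flat v : steep v -> flat v -> False.
Proof. rewrite /steep /flat; lia. Qed.

Definition head_letter (b : bool) (l : seq syll) : bool :=
  if l is x :: _ then x.1 == b else false.

(* Ping-pong: [s]-powers send flat vectors to steep ones, [t]-powers the other way round. *)
Lemma reduced_pingpong l : reduced l ->
  (if head_letter true l then steep else flat) (sylls_act l (1, 0)) /\
  (if head_letter false l then flat else steep) (sylls_act l (0, 1)).
Proof.
elim: l => [|[b e] l IH] // /[dup] /reduced_behead /IH [h1 h2] {IH}.
case/and3P=> /= e0 hl rl; case: b hl => /= hl; split.
- apply: syll_act_steep => //; move: h1; case: l hl {rl h2} => //= -[b' e'] l /=.
  by case: b'.
- case: l hl {rl h1} h2 => [|[[] e'] l] //= _.
    by rewrite /syll_act /steep /Vmap /=; lia.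
  exact: syll_act_steep.
- case: l hl {rl h2} h1 => [|[[] e'] l] //= _.
    by rewrite /syll_act /flat /Umap /=; lia.
  exact: syll_act_flat.
- apply: syll_act_flat => //; move: h2; case: l hl {rl h1} => //= -[b' e'] l /=.
  by case: b'.
Qed.

(** A nonempty normal form moves the flat vector [(1, 0)] to a steep one or the steep vector
    [(0, 1)] to a flat one, according to its first letter. *)
Lemma reduced_act_nil l : reduced l -> sylls_act l =1 id -> l = [::].
Proof.
move=> /reduced_pingpong; case: l => // -[[] e] l /= [h1 h2] E.
  by case: (@steep_flat (1, 0)) => //; rewrite -[X in steep X]E.
by case: (@steep_flat (0, 1)) => //; rewrite -[X in flat X]E.
Qed.

Definition syll_inv (x : syll) : syll := (x.1, - x.2).
Definition sylls_inv (l : seq syll) : seq syll := rev (map syll_inv l).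

Lemma syll_invK x v : syll_act (syll_inv x) (syll_act x v) = v.
Proof. by case: x => b e; rewrite -syll_actD addNr syll_act0. Qed.

Lemma syll_Kinv x v : syll_act x (syll_act (syll_inv x) v) = v.
Proof. by case: x => b e; rewrite -syll_actD addrN syll_act0. Qed.

Lemma sylls_invK l v : sylls_act (sylls_inv l) (sylls_act l v) = v.
Proof.
elim: l v => //= x l IH v.
by rewrite /sylls_inv /= rev_cons -cats1 sylls_act_cat /= syll_invK IH.
Qed.

Lemma pushK x l : reduced l -> push (syll_inv x) (push x l) = l.
Proof.
case: x => b e; rewrite /push /= oppr_eq0; case: (eqVneq e 0) => [_|e0] //= rl.
case: l rl => [|[b' e'] l] /=; first by rewrite eqxx addNr eqxx.
case/and3P=> e'0 hl rl; case: (eqVneq b b') => [Eb|_] /=; last by rewrite eqxx addNr eqxx.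
subst b'; case: eqP => [E|_] /=; last by rewrite eqxx addKr (negPf e'0).

by rewrite /syll_inv; case: l hl {rl} => [|[b2 e2] l] /= => [_|/negPf ->]; congr cons; congr pair; lia.
Qed.

(** Pushing the inverse of the first syllable of [l] onto both sides shortens [l], so induction
    applies, and [pushK] undoes the push. From here on, identities between normal forms reduce to
    identities between actions. *)
Lemma reduced_uniq l r : reduced l -> reduced r -> sylls_act l =1 sylls_act r -> l = r.
Proof.
elim: l r => [|x l IH] r rl rr E.
  by apply/esym/(reduced_act_nil rr) => v; rewrite -E.
have E2 : push (syll_inv x) (x :: l) = push (syll_inv x) r.
  have -> : push (syll_inv x) (x :: l) = l.
    have {1}-> : x :: l = push x l; last by apply: pushK; case/and3P: rl.
    case/and3P: rl => x0 hl _; rewrite /push (negPf x0).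
    by case: (l) hl => // y l' /negPf ->.
  apply: IH; first by case/and3P: rl.
    exact: push_reduced.
  by move=> v; rewrite push_act -E /= syll_invK.
have := pushK (syll_inv x) rl; have := pushK (syll_inv x) rr.
by rewrite E2 => -> <-.
Qed.

Lemma reduce_eq l r : sylls_act l =1 sylls_act r -> reduce l = reduce r.
Proof.
by move=> E; apply: reduced_uniq; rewrite ?reduce_reduced // => v; rewrite !reduce_act.
Qed.

Lemma reduce_id l : reduced l -> reduce l = l.
Proof. by move=> rl; apply: reduced_uniq; rewrite ?reduce_reduced // => v; rewrite reduce_act. Qed.

Lemma reduce_cat l r : reduce (l ++ r) = pushs l (reduce r).
Proof. exact: foldr_cat. Qed.

Lemma pushs_reduce l r : reduced r -> pushs (reduce l) r = pushs l r.
Proof.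
move=> rr; apply: reduced_uniq; rewrite ?pushs_reduced // => v.
by rewrite !pushs_act !sylls_act_cat reduce_act.
Qed.

Lemma pushs_invK l r : reduced r -> pushs (sylls_inv l) (pushs l r) = r.
Proof.
move=> rr; apply: reduced_uniq; rewrite ?pushs_reduced ?pushs_reduced // => v.
by rewrite pushs_act sylls_act_cat pushs_act sylls_act_cat sylls_invK.
Qed.

Lemma push_add b e f r : reduced r -> push (b, e) (push (b, f) r) = push (b, e + f) r.
Proof.
move=> rr; apply: reduced_uniq; rewrite ?push_reduced // => v.
by rewrite !push_act syll_actD.
Qed.

End FreeNormalForms.

(** * Conjugated transitions *)

Inductive state := Start | Stop | Main of nat | Fire of nat | Back of nat | Pop.

Definition state_index (p : state) : nat :=
  match p with
  | Start => 0 | Stop => 1 | Pop => 2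
  | Main n => 3 * n + 3 | Fire n => 3 * n + 4 | Back n => 3 * n + 5
  end.

Lemma state_index_inj : injective state_index.
Proof. by case=> [||n|n|n|] [||m|m|m|] //= E; try congr (_ _); lia. Qed.

Section Control.
Local Open Scope ring_scope.

(** Pairwise distinct exponents prime to 3: [Start] alone has residue 1, all other states have
    residue 2. *)
Definition key_exp (p : state) : int :=
  if p is Start then 1 else 3 * (state_index p)%:Z + 2.

(** The key of [Start] is the image of the commutator [gamma0]. In a key [s^k t s^k t] the first
    half survives and identifies the state; the second half is the part that may cancel against an
    inverse key following it. *)
Definition key_sylls (p : state) : seq syll :=
  match p with
  | Start => [:: (true, 1); (false, 1); (true, -1); (false, -1)]
  | Stop => [::]
  | _ => [:: (true, key_exp p); (false, 1); (true, key_exp p); (false, 1)]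
  end.

Definition mult3 (l : seq syll) : bool := all (fun x : syll => (3 %| x.2)%Z) l.

Lemma key_exp_inj p q : key_exp p = key_exp q -> p = q.
Proof.
move=> E; apply: state_index_inj; move: E.
by case: p => [||n|n|n|]; case: q => [||m|m|m|] /=; lia.
Qed.

Lemma push_mult3 x l : (3 %| x.2)%Z -> mult3 l -> mult3 (push x l).
Proof.
case: x => b e; rewrite /push /= => d3; case: eqP => // _.
case: l => [|[b' e'] l] /=; first by rewrite d3.
by case/andP=> d' hl; case: eqP => _; [case: eqP => _ //=; rewrite hl andbT; lia|rewrite /= d3 d' hl].
Qed.

Lemma reduce_mult3 l : mult3 l -> mult3 (reduce l).
Proof. by elim: l => //= x l IH /andP [d3 /IH]; apply: push_mult3. Qed.

Lemma pushs_reduced_cat l r : reduced (l ++ r) -> pushs l r = l ++ r.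
Proof.
elim: l => //= -[b e] l IH /and3P [e0 h rl].
by rewrite IH // /push (negPf e0); case: (l ++ r) h => //= y s /negPf ->.
Qed.

Lemma reduced_rcons_cat l b e f r : reduced (rcons l (b, e)) -> reduced ((b, f) :: r) ->
  reduced (l ++ (b, f) :: r).
Proof.
move=> rl rr; elim: l rl => // x l IH.
rewrite rcons_cons => /and3P [x0 h /IH rl].
rewrite cat_cons; apply/and3P; split=> //.
by case: (l) h.
Qed.

Definition head_prop3 (r : seq syll) : bool :=
  if r is x :: _ then ~~ (3 %| x.2)%Z else true.

(** Only the last syllable of [w] can merge with [r], and the merged exponent stays prime to 3,
    hence nonzero, so the cancellation stops there. The second alternative arises when [w] is a
    single syllable absorbed into the head of [r]. *)
Lemma head_pushs w r : reduced w -> mult3 w -> w <> [::] -> reduced r -> head_prop3 r ->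
  exists x s, pushs w r = x :: s /\
    ((3 %| x.2)%Z \/ exists2 y, r = y :: s & [/\ x.1 = y.1, (3 %| x.2 - y.2)%Z & x.2 != y.2]).
Proof.
case: (lastP w) => // w' [b e] rw m3 _ rr hr.
have e0 : e != 0.
  by elim: (w') rw => [/and3P []//|x l IH]; rewrite rcons_cons => /and3P [_ _ /IH].
have d3 : (3 %| e)%Z by move: m3; rewrite /mult3 all_rcons => /andP [].
have [g [s [E Hg]]] : exists g s, push (b, e) r = (b, g) :: s /\
   ((3 %| g)%Z \/ exists2 y, r = y :: s & [/\ b = y.1, (3 %| g - y.2)%Z & g != y.2]).
  rewrite /push /= (negPf e0); case: r hr {rr} => [|[b' f] r] /= hr.
    by exists e, [::]; split=> //; left.
  case: (eqVneq b b') => [<-|_]; last by exists e, ((b', f) :: r); split=> //; left.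
  have -> : (e + f == 0) = false by apply/negP; lia.
  exists (e + f), r; split=> //; right; exists (b, f) => //=; split=> //; first by lia.
  by apply/negP; lia.
have E2 : pushs (rcons w' (b, e)) r = w' ++ (b, g) :: s.
  rewrite -cats1 /pushs foldr_cat /= E -/(pushs _ _) pushs_reduced_cat //.
  by apply: reduced_rcons_cat rw _; rewrite -E; apply: push_reduced.
rewrite E2; case: w' rw m3 E2 => [|x w'] rw m3 _ /=; first by exists (b, g), s.
by exists x, (w' ++ (b, g) :: s); split=> //; left; case/andP: m3.
Qed.

(** The third exponent is left free, since at this place the key of [p] may have merged with a
    following inverse key. *)
Definition keyed (p : state) (r : seq syll) : Prop :=
  exists y s, r = [:: (true, key_exp p), (false, 1), (true, y) & s].

Definition joint_ok (q : state) (r : seq syll) : Prop :=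
  r = [::] \/ exists2 p, keyed p r & p <> q.

Lemma key_exp_prop3 p : ~~ (3 %| key_exp p)%Z.
Proof. by rewrite /key_exp; case: p => *; lia. Qed.

Lemma key_exp_neq0 p : key_exp p != 0.
Proof. by apply/negP=> /eqP E; have := key_exp_prop3 p; rewrite E. Qed.

Lemma push_other b e x l : e != 0 -> b != x.1 -> push (b, e) (x :: l) = (b, e) :: x :: l.
Proof. by rewrite /push /= => /negPf -> /negPf ->. Qed.

Lemma push_same b e f l : e != 0 -> e + f != 0 -> push (b, e) ((b, f) :: l) = (b, e + f) :: l.
Proof. by rewrite /push /= => /negPf -> /negPf ->; rewrite eqxx. Qed.

(* The inverse key of the state a segment ends in cannot be absorbed by a different key following it. *)
Lemma pushs_key_inv q r : q <> Start -> q <> Stop -> reduced r -> joint_ok q r ->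
  exists s, pushs (sylls_inv (key_sylls q)) r = [:: (false, -1), (true, - key_exp q) & s].
Proof.
move=> qS qZ rr jr.
have -> : sylls_inv (key_sylls q) =
   [:: (false, -1); (true, - key_exp q); (false, -1); (true, - key_exp q)].
  by case: q qS qZ {jr}.
have n0 : - key_exp q != 0 by rewrite oppr_eq0 key_exp_neq0.
case: jr => [->|[p [y [s ->]] pq]] /=.
  exists [:: (false, -1); (true, - key_exp q)].
  by rewrite [push (true, _) [::]]/push /= (negPf n0) !push_other.
have n1 : - key_exp q + key_exp p != 0.
  by apply/negP=> /eqP E; apply: pq; apply: key_exp_inj; lia.
by eexists; rewrite push_same // (push_other _ (x := (true, _))) // push_other // push_other //.
Qed.

Section Segment.
Variables (p q : state) (w r : seq syll).
Hypotheses (pZ : p <> Stop) (qS : q <> Start) (rw : reduced w) (mw : mult3 w).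
Hypotheses (cyc : p = q -> w <> [::]) (rr : reduced r) (jr : joint_ok q r).

Let r1 := pushs (sylls_inv (key_sylls q)) r.
Let r2 := pushs w r1.

Let rr1 : reduced r1. Proof. exact: pushs_reduced. Qed.
Let rr2 : reduced r2. Proof. exact: pushs_reduced. Qed.

(** The exclusions are those needed afterwards: an exponent [-1] of [t] would cancel the final [t]
    of a key, and an exponent [1] of [s] would imitate the key of [Start]. *)
Lemma segment_head :
  (w = [::] /\ q = Stop) \/
  (w = [::] /\ exists s, r2 = [:: (false, -1), (true, - key_exp q) & s]) \/
  (exists x s, r2 = x :: s /\ ((3 %| x.2)%Z \/
     ((x.1 = false /\ (3 %| x.2 + 1)%Z /\ x.2 != -1) \/
      (x.1 = true /\ ~~ (3 %| x.2)%Z /\ x.2 != 1)))).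
Proof.
case: (eqVneq w [::]) => [w0|/eqP w0].
  case: (eqVneq (state_index q) (state_index Stop)) => [/state_index_inj|/eqP nq]; first by left.
  right; left; split=> //; rewrite /r2 w0; apply: pushs_key_inv => // E.
  by apply: nq; rewrite E.
right; right.
case: (eqVneq (state_index q) (state_index Stop)) => [/state_index_inj qZ|/eqP nq].
  have hp : head_prop3 r1.
    rewrite /r1 qZ /=; case: jr => [->//|[p' [y [s ->]] _]] /=; exact: key_exp_prop3.
  case: (head_pushs rw mw w0 rr1 hp) => x [s [E Hx]]; exists x, s; split=> //.
  case: Hx => [|[z Ez [h1 h2 h3]]]; first by left.
  right; right; move: Ez; rewrite /r1 qZ /=; case: jr => [->//|[p' [y [s' ->]] _]] [Ez _].
  move: h1 h2 h3; rewrite -Ez /= => -> h2 h3; split=> //.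
  have k3 := key_exp_prop3 p'.
  split; first by apply/negP => ?; move/negP: k3; apply; lia.
  (* For [Start] the old exponent is 1 and has changed; for every other state the residue modulo 3
     is 2. *)
  apply/negP=> /eqP E1; move: h2 h3; rewrite E1; case: (p') => [||n|n|n|]; rewrite /key_exp /=; lia.
have [s Es] := pushs_key_inv qS (fun E => nq (congr1 state_index E)) rr jr.
have hp : head_prop3 r1 by rewrite /r1 Es.
case: (head_pushs rw mw w0 rr1 hp) => x [s' [E Hx]]; exists x, s'; split=> //.
case: Hx => [|[z Ez [h1 h2 h3]]]; first by left.
right; left; move: Ez; rewrite /r1 Es => -[Ez _].
by move: h1 h2 h3; rewrite -Ez /= => -> h2 h3; split=> //; split=> //; lia.
Qed.

Lemma keyed_push s0 : reduced s0 ->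
  (forall e s, s0 = (false, e) :: s -> e + (if p is Start then -1 else 1) != 0) ->
  keyed p (pushs (key_sylls p) s0).
Proof.
set sg := if p is Start then _ else _ => rs h.
have sg0 : sg != 0 by rewrite /sg; case: (p).
have [g [s E]] : exists g s, push (false, sg) s0 = (false, g) :: s.
  case: s0 rs h => [|[[] e] s] rs h.
  - by exists sg, [::]; rewrite /push /= (negPf sg0).
  - by exists sg, ((true, e) :: s); rewrite push_other.
  - by exists (sg + e), s; rewrite push_same // addrC; apply: h.
have n0 := key_exp_neq0 p.
move: sg0 E; rewrite /sg /keyed; case: (p) pZ n0 => //= [_ n0 _ E|n _ n0 _ E|n _ n0 _ E|n _ n0 _ E|_ n0 _ E];
  by do 2!eexists; rewrite E !push_other.
Qed.

(** The delicate case is an empty [w] with [p] different from [Start] and [q] from [Stop]: the final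
    [t] of the key of [p] cancels against the initial [t^-1] of the inverse key of [q], and the next
    syllables combine to [key_exp p - key_exp q], nonzero because [cyc] excludes [p = q]. *)
Lemma segment_keyed : keyed p (pushs (key_sylls p) r2).
Proof.
case: segment_head => [[w0 qZ]|[[w0 [s E]]|[[b e] [s [E H]]]]].
- apply: keyed_push => // e s; rewrite /r2 w0 /r1 qZ /=.
  by case: jr => [->|[p' [y [s' ->]] _]].
- case: (eqVneq (state_index p) (state_index Start)) => [/state_index_inj pS|/eqP nS].
    by apply: keyed_push => // e s'; rewrite E pS => -[<-].
  have pq : key_exp p - key_exp q != 0.
    by apply/negP=> /eqP E1; apply: (cyc _ w0); apply: key_exp_inj; lia.
  have n0 := key_exp_neq0 p.
  have -> : key_sylls p = [:: (true, key_exp p); (false, 1); (true, key_exp p); (false, 1)].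
    by case: (p) pZ nS.
  rewrite /keyed E /= [push (false, 1) _]/push /=.
  by do 2!eexists; rewrite push_same // !push_other.
- apply: keyed_push => // e' s'; rewrite E => -[Eb Ee _]; move: H; rewrite /= Eb Ee.
  case=> [d3|[[_ [d3 h]]|[//]]]; first by case: (p) => *; apply/negP; lia.
  by apply/negP => /eqP E1; move: d3 h E1; case: (p) => *; lia.
Qed.

Lemma segment_trivial : r2 = [::] \/ keyed Start r2 -> w = [::] /\ q = Stop.
Proof.
move=> Hk; case: segment_head => [//|[[w0 [s' E]]|[[b e] [s' [E H]]]]].
  by case: Hk; rewrite E // => -[y [s2]].
case: Hk; rewrite E // => -[y [s2 [Eb Ee _]]]; move: H; rewrite /= Eb Ee.
by case=> [|[[]//|[_ []]]]; lia.
Qed.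

End Segment.

Definition segment := (state * seq syll * state)%type.

Definition segment_sylls (x : segment) : seq syll :=
  let: (p, w, q) := x in key_sylls p ++ w ++ sylls_inv (key_sylls q).

Definition chain_sylls (l : seq segment) : seq syll := flatten (map segment_sylls l).

(** Joints between equal states are forbidden since such segments can be fused. A closed segment
    needs nontrivial content, as otherwise its key would cancel against its own inverse. *)
Fixpoint chain (l : seq segment) : Prop :=
  if l is (p, w, q) :: l' then
    [/\ p <> Stop, q <> Start, mult3 w, p = q -> reduce w <> [::] &
       (if l' is (p', _, _) :: _ then p' <> q else True) /\ chain l']
  else True.

Fixpoint chain_trivial (l : seq segment) : Prop :=
  if l is (p, w, q) :: l' then
    [/\ p = Start, q = Stop, reduce w = [::] & chain_trivial l']
  else True.

Lemma chain_cons_reduce p w q l :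
  reduce (chain_sylls ((p, w, q) :: l)) =
  pushs (key_sylls p) (pushs (reduce w) (pushs (sylls_inv (key_sylls q)) (reduce (chain_sylls l)))).
Proof.
rewrite /chain_sylls /= -!catA !reduce_cat pushs_reduce //.
exact/pushs_reduced/reduce_reduced.
Qed.

Lemma chain_joint q l : chain l -> (if l is (p', _, _) :: _ then p' <> q else True) ->
  joint_ok q (reduce (chain_sylls l)).
Proof.
elim: l q => [|[[p w] q'] l IH] q; first by left.
case=> pZ qS mw cyc [jn /IH/(_ jn) jl] pq; right; exists p => //.
rewrite chain_cons_reduce; apply: segment_keyed => //; try exact: reduce_reduced.
exact: reduce_mult3.
Qed.

Definition gamma_pow_sylls (k : nat) : seq syll := flatten (nseq k (key_sylls Start)).

Lemma gamma_pow_keyed k : reduced (gamma_pow_sylls k) /\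
  (gamma_pow_sylls k = [::] \/ keyed Start (gamma_pow_sylls k)).
Proof.
elim: k => [|k [rk hk]]; first by split=> //; left.
split; last by right; rewrite /gamma_pow_sylls /=; do 2!eexists.
rewrite /gamma_pow_sylls /= -/(gamma_pow_sylls k) rk.
by case: hk => [->|[y [s ->]]].
Qed.

(** The normal form starts with the key of the first state, which must therefore be [Start]. Once
    this key is removed on both sides, a smaller power of [gamma0] remains, and [segment_trivial]
    shows that the segment has ended; so each segment uses up one factor. *)
Lemma chain_control k l : chain l ->
  reduce (chain_sylls l) = reduce (gamma_pow_sylls k) -> chain_trivial l.
Proof.
elim: l k => [|[[p w] q] l IH] k //= [pZ qS mw cyc [jn cl]] E.
have jl := chain_joint cl jn.
have rl := reduce_reduced (chain_sylls l).
have rw := reduce_reduced w.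
have m3 := reduce_mult3 mw.
have [rk hk] := gamma_pow_keyed k.
have [y [s Ek]] := segment_keyed pZ qS rw m3 cyc rl jl.
move: E; rewrite chain_cons_reduce [RHS]reduce_id //; case: k rk hk => [|k] rk hk E.
  by rewrite Ek in E.
have pS : p = Start.
  by apply: key_exp_inj; move: E; rewrite Ek => -[].
have [rk' hk'] := gamma_pow_keyed k.
have E2 : pushs (reduce w) (pushs (sylls_inv (key_sylls q)) (reduce (chain_sylls l))) = gamma_pow_sylls k.
  have r2 := pushs_reduced (reduce w) (pushs_reduced (sylls_inv (key_sylls q)) rl).
  rewrite -[LHS](pushs_invK (key_sylls p) r2) E pS -[RHS](pushs_invK (key_sylls Start) rk').
  congr pushs; rewrite (_ : gamma_pow_sylls k.+1 = key_sylls Start ++ gamma_pow_sylls k) //.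
  by rewrite pushs_reduced_cat.
have [w0 qZ] : reduce w = [::] /\ q = Stop.
  by apply: segment_trivial qS rw m3 rl jl _; rewrite E2.
split=> //; apply: (IH k) => //.
by move: E2; rewrite (reduce_id rk') w0 qZ.
Qed.

End Control.

(** * The counter automaton *)

Inductive gen := GA | GB | GC | GD.
Definition content := seq (gen * int).

Record rule := Rule {
  rule_src : nat; rule_mod : nat; rule_rem : nat;
  rule_mul : nat; rule_add : nat; rule_dst : nat }.

Section Automaton.
Local Open Scope ring_scope.

(* The images under [psi_1] ([first = true]) and [psi_2] ([first = false]). *)
Definition gen_sylls (first : bool) (x : gen * int) : syll :=
  match x.1 with
  | GA => (true, x.2)
  | GB => (true, if first then 0 else 2 * x.2)
  | GC => (false, if first then x.2 else 0)
  | GD => (false, x.2)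
  end.

Definition content_sylls (first : bool) (w : content) : seq syll :=
  map (gen_sylls first) w.

Variables (rules : seq rule) (halt : nat).

Definition rule_at (i : nat) : rule := nth (Rule 0 0 0 0 0 0) rules i.

Inductive sim_halts : nat -> nat -> Prop :=
| sim_done n : sim_halts halt n
| sim_step i k : (i < size rules)%N ->
    sim_halts (rule_dst (rule_at i)) (rule_mul (rule_at i) * k + rule_add (rule_at i)) ->
    sim_halts (rule_src (rule_at i)) (rule_mod (rule_at i) * k + rule_rem (rule_at i)).

Inductive work_edge : state -> content -> state -> Prop :=
| work_enter i : (i < size rules)%N ->
    work_edge (Main (rule_src (rule_at i)))
      [:: (GC, - (6 * (rule_rem (rule_at i))%:Z)); (GB, 3 * (rule_add (rule_at i))%:Z)] (Fire i)
| work_loop i : (i < size rules)%N ->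
    work_edge (Fire i)
      [:: (GC, - (6 * (rule_mod (rule_at i))%:Z)); (GB, 3 * (rule_mul (rule_at i))%:Z)] (Fire i)
| work_exit i : (i < size rules)%N ->
    work_edge (Fire i) [:: (GA, 3)] (Back (rule_dst (rule_at i)))
| work_back c : work_edge (Back c) [:: (GB, - 3); (GC, 6)] (Back c)
| work_next c : work_edge (Back c) [:: (GD, 3)] (Main c)
| work_drop : work_edge (Main halt) [:: (GC, - 6)] (Main halt).

Inductive edge (N : nat) : state -> content -> state -> Prop :=
| edge_start : edge N Start [:: (GC, 6 * N%:Z)] (Main 0)
| edge_work p w q : work_edge p w q -> edge N p w q
| edge_end : edge N (Main halt) [::] Pop
| edge_pop : edge N Pop [:: (GD, - 3); (GA, - 3)] Pop
| edge_stop : edge N Pop [::] Stop.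

Inductive walk (E : state -> content -> state -> Prop) : state -> content -> state -> Prop :=
| walk_nil p : walk E p [::] p
| walk_cons p u r w q : E p u r -> walk E r w q -> walk E p (u ++ w) q.

Definition clean_sylls (T : nat) : seq syll := flatten (nseq T [:: (true, 3); (false, 3)]).

Lemma push0 b l : push (b, 0) l = l.
Proof. by []. Qed.

Lemma reduce_cons x l : reduce (x :: l) = push x (reduce l).
Proof. by []. Qed.

(** [r1] and [r2] are the two normal forms of the rest of a walk to [Main halt]. An exponent [6 z]
    is a pure counter and may vanish; [6 z + 3] is a counter merged with a separator and cannot. *)
Definition work_shape (p : state) (r1 r2 : seq syll) : Prop :=
  match p with
  | Main _ =>
    (exists z Y, r1 = push (false, 6 * z) Y /\ (Y = [::] \/ exists Y', Y = (true, 3) :: Y')) /\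
    (r2 = [::] \/ exists z Y', r2 = [:: (true, 6 * z + 3), (false, 3) & Y'])
  | Fire _ =>
    (exists z Y', r1 = push (false, 6 * z) ((true, 3) :: Y')) /\
    (exists z Y', r2 = [:: (true, 6 * z + 3), (false, 3) & Y'])
  | Back _ =>
    (exists z Y, r1 = (false, 6 * z + 3) :: Y) /\
    (exists z Y, r2 = push (true, 6 * z) ((false, 3) :: Y))
  | _ => True
  end.

Lemma push_nz b e l : e != 0 -> (if l is x :: _ then b != x.1 else true) ->
  push (b, e) l = (b, e) :: l.
Proof. by rewrite /push /= => /negPf ->; case: l => // y l /negPf ->. Qed.

Lemma reduced_push_inv b e l : (if l is x :: _ then b != x.1 else true) ->
  reduced (push (b, e) l) -> reduced l.
Proof.
rewrite /push /=; case: eqP => // _; case: l => // y l /negPf h.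
by rewrite h => /reduced_behead.
Qed.

Lemma push_same0 b e f l : e + f != 0 -> push (b, e) ((b, f) :: l) = (b, e + f) :: l.
Proof.
case: (eqVneq e 0) => [->|e0 ef]; last exact: push_same.
by rewrite push0 add0r.
Qed.

Lemma reduced_push_other b e x l : b != x.1 -> reduced (push (b, e) (x :: l)) -> reduced (x :: l).
Proof. exact: (@reduced_push_inv b e (x :: l)). Qed.

Lemma work_walk_shape p w q : walk work_edge p w q -> q = Main halt ->
  work_shape p (reduce (content_sylls true w)) (reduce (content_sylls false w)).
Proof.
elim=> {p w q} [p ->|p u r w q e _ IH /IH {IH}] /=.
  by split; [exists 0, [::]; split=> //; left|left].
have := reduce_reduced (content_sylls true w).
have := reduce_reduced (content_sylls false w).
rewrite /content_sylls.
case: e => [i _|i _|i _|c|c|]; rewrite map_cat /reduce /pushs foldr_cat;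
  rewrite map_cat foldr_cat /= /gen_sylls /= ?push0 ?mulr0 -/(pushs _ _) -/(reduce _);
  rewrite -/(pushs (map _ w) [::]) -/(reduce (map _ w));
  move: (reduce _) (reduce _) => r1 r2 rr2 rr1.
- case=> [[z [Y E]] [z' [Y' E']]]; split.
    exists (z - (rule_rem (rule_at i))%:Z), ((true, 3) :: Y); split; last by right; exists Y.
    rewrite E push_add; last by move: rr1; rewrite E; apply: reduced_push_other.
    by congr (push (_, _)); ring.
  right; exists (z' + (rule_add (rule_at i))%:Z), Y'.
  by rewrite E' push_same0; [congr ((_, _) :: _); ring|lia].
- case=> [[z [Y E]] [z' [Y' E']]]; split.
    exists (z - (rule_mod (rule_at i))%:Z), Y.
    rewrite E push_add; last by move: rr1; rewrite E; apply: reduced_push_other.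
    by congr (push (_, _)); ring.
  exists (z' + (rule_mul (rule_at i))%:Z), Y'.
  by rewrite E' push_same0; [congr ((_, _) :: _); ring|lia].
- case=> [[z [Y E]] [z' [Y' E']]]; split.
    by exists 0, ((false, 6 * z + 3) :: Y); rewrite E push_other.
  exists z', Y'.
  rewrite E' push_add; last by move: rr2; rewrite E'; apply: reduced_push_other.
  by rewrite push_nz //; [congr ((_, _) :: _); ring|lia].
- case=> [[z [Y E]] [z' [Y' E']]]; split.
    exists (z + 1), Y.
    by rewrite E push_same0; [congr ((_, _) :: _); ring|lia].
  exists (z' - 1), Y'.
  rewrite E' push_add; last by move: rr2; rewrite E'; apply: reduced_push_other.
  by congr (push (_, _)); ring.
- case=> [[z [Y [E HY]]] E']; split.
    exists z, Y; rewrite E push_add; last first.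
      by move: rr1; rewrite E; apply: reduced_push_inv; case: HY => [->|[Y' ->]].
    by rewrite push_nz; [congr ((_, _) :: _); ring|lia|case: HY => [->|[Y' ->]]].
  exists 0, r2; rewrite mulr0 push0 push_nz //.
  by case: E' => [->|[z' [Y' ->]]].
- case=> [[z [Y [E HY]]] E']; split=> //.
  exists (z - 1), Y; split=> //.
  rewrite E push_add; last by move: rr1; rewrite E; apply: reduced_push_inv; case: HY => [->|[Y' ->]].
  by congr (push (_, _)); ring.
Qed.

Lemma content_push first x w :
  reduce (content_sylls first (x :: w)) = push (gen_sylls first x) (reduce (content_sylls first w)).
Proof. by []. Qed.

(* A block is closed only if its counter is exhausted: the counter exponents of [psi_1] and [psi_2] must vanish cell by cell. *)
Definition work_sound (p : state) (r1 r2 : seq syll) : Prop :=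
  match p with
  | Main c => forall (n T : nat),
      push (false, 6 * n%:Z) r1 = clean_sylls T -> r2 = clean_sylls T -> sim_halts c n
  | Fire i => forall (x y : int) (T : nat),
      push (false, 6 * x) r1 = clean_sylls T -> push (true, 6 * y) r2 = clean_sylls T ->
      exists k m : nat, [/\ x = (rule_mod (rule_at i) * k)%:Z,
        m%:Z = y + (rule_mul (rule_at i) * k)%:Z & sim_halts (rule_dst (rule_at i)) m]
  | Back c => forall (x y : int) (T : nat), 0 <= x ->
      push (true, 3) (push (false, 6 * x) r1) = clean_sylls T ->
      push (true, 6 * y + 3) r2 = clean_sylls T ->
      exists2 m : nat, m%:Z = x + y & sim_halts c m
  | _ => True
  end.

Lemma clean_head T x l : clean_sylls T = x :: l ->
  exists T', [/\ T = T'.+1, x = (true, 3) & l = (false, 3) :: clean_sylls T'].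
Proof. by case: T => // T [<- <-]; exists T. Qed.

Lemma push_false_clean x l T : push (false, 6 * x) ((true, 3) :: l) = clean_sylls T -> x = 0.
Proof.
case: (eqVneq x 0) => // x0; rewrite push_nz //; last by lia.
by move/esym/clean_head => [T' [_]].
Qed.

(** Induction from the end of the walk: [x] and [y] are the numbers of units [c^6] and [b^3]
    standing to the left. At [Fire] they may have any sign, because only leaving the loop shows how
    often it was run; [k] is the number of passes still to come. *)
Lemma work_walk_sound p w q : walk work_edge p w q -> q = Main halt ->
  work_sound p (reduce (content_sylls true w)) (reduce (content_sylls false w)).
Proof.
elim=> {p w q} [p ->|p u r w q e W IH qh].
  by move=> n T _ _; apply: sim_done.
have := work_walk_shape W qh; have := IH qh => {IH W qh}.
have := reduce_reduced (content_sylls true w).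
have := reduce_reduced (content_sylls false w).
case: e => [i ii|i ii|i ii|c|c|];
  rewrite ?cat_cons cat0s !content_push /gen_sylls /= ?push0 ?mulr0;
  move: (reduce _) (reduce _) => r1 r2 rr2 rr1.
- move=> IH _ n T; rewrite !push_add // => E1 E2.
  case: (IH (n%:Z - (rule_rem (rule_at i))%:Z) (rule_add (rule_at i))%:Z T).
  + by rewrite -E1; congr (push (_, _)); ring.
  + by rewrite -E2; congr (push (_, _)); ring.
  move=> k [m [Ek Em S]].
  have -> : n = (rule_mod (rule_at i) * k + rule_rem (rule_at i))%N by lia.
  by apply: sim_step => //; have -> : (rule_mul (rule_at i) * k + rule_add (rule_at i))%N = m by lia.
- move=> IH _ x y T; rewrite !push_add // => E1 E2.
  case: (IH (x - (rule_mod (rule_at i))%:Z) (y + (rule_mul (rule_at i))%:Z) T).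
  + by rewrite -E1; congr (push (_, _)); ring.
  + by rewrite -E2; congr (push (_, _)); ring.
  by move=> k [m [Ek Em S]]; exists k.+1, m; split=> //; lia.
- move=> IH [[z [Y E]] _] x y T E1 E2.
  (* The whole product begins with [s^3], so no power of [t] can stand before the separator [a^3]:
     the counter in [c] is exhausted. *)
  have x0 : x = 0.
    by move: E1; rewrite E [push (true, 3) _]push_other //; apply: push_false_clean.
  move: E1 E2; rewrite x0 mulr0 push0 push_add // => E1 E2.
  case: (IH 0 y T) => //.
  by move=> m Em S; exists 0, m; split=> //; lia.
- move=> IH _ x y T x0; rewrite !push_add // => E1 E2.
  case: (IH (x + 1) (y - 1) T) => //; first by lia.
  + by rewrite -E1; congr push; congr (push (_, _)); ring.
  + by rewrite -E2; congr (push (_, _)); ring.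
  by move=> m Em S; exists m => //; lia.
- move=> IH [[z [Y [E HY]]] H2] x y T x0.
  have rY : reduced Y.
    by move: rr1; rewrite E; apply: reduced_push_inv; case: HY => [->|[Y' ->]].
  have -> : push (false, 6 * x) (push (false, 3) r1) = (false, 6 * (x + z) + 3) :: Y.
    rewrite E [push _ (push _ Y)]push_add // push_add // push_nz; last 2 first.
    - by lia.
    - by case: HY => [->|[Y' ->]].
    by congr ((_, _) :: _); ring.
  (* The second syllable must be exactly [t^3], whence [z = - x]: the next block consumes just what
     this one has restored. *)
  rewrite push_other // => /esym/clean_head [T' [-> _ [Ez EY]]].
  rewrite [push (false, 3) r2]push_nz //; last by case: H2 => [->|[z' [Y' ->]]].
  rewrite push_nz //; last by lia.
  (* Likewise the first syllable under [psi_2] must be [s^3], which forces [y = 0]: the counter in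
     [b] is exhausted. *)
  move/esym/clean_head => [T'' [[<-] [Ey] [Er2]]].
  have [m Em] : exists m : nat, x = m%:Z by exists `|x|%N; lia.
  exists m; first by lia.
  apply: (IH m T') => //; rewrite E push_add // -Em -EY.
  by rewrite (_ : 6 * x + 6 * z = 0) ?push0 //; lia.
- by move=> IH _ n T _ _; apply: sim_done.
Qed.

Definition pop_content (T : nat) : content := flatten (nseq T [:: (GD, - 3); (GA, - 3)]).

(** From a working state the only way to [Stop] leads through [Main halt] and [Pop], so separators
    are removed only at the very end. *)
Lemma walk_to_stop N p w q : walk (edge N) p w q -> q = Stop -> p <> Start ->
  match p with
  | Stop => w = [::]
  | Pop => exists T, w = pop_content T
  | _ => exists w' T, walk work_edge p w' (Main halt) /\ w = w' ++ pop_content T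
  end.
Proof.
elim=> {p w q} [p -> //|p u r w q e _ IH /IH {IH}].
case: e => [|{p u r}p u r e|||] IH //.
- by move=> _; case: e IH => [i ii|i ii|i ii|c|c|] IH; case: IH => // w' [T [W ->]];
    eexists; exists T; (split; last by rewrite catA); apply: walk_cons W; constructor.
- by move=> _; case: IH => // T ->; exists [::], T; split=> //; apply: walk_nil.
- by move=> _; case: IH => // T ->; exists T.+1.
- by move=> _; rewrite IH //; exists 0.
Qed.

Lemma clean_sylls_rcons T : clean_sylls T.+1 = clean_sylls T ++ [:: (true, 3); (false, 3)].
Proof.
by elim: T => // T IH; exact: (congr1 (cat [:: (true, 3); (false, 3)]) IH).
Qed.

Lemma pop_clean first T v :
  sylls_act (content_sylls first (pop_content T)) (sylls_act (clean_sylls T) v) = v.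
Proof.
elim: T v => // T IH v; rewrite clean_sylls_rcons sylls_act_cat.
rewrite -[pop_content T.+1]/([:: (GD, - 3); (GA, - 3)] ++ pop_content T).
rewrite /content_sylls map_cat sylls_act_cat IH /= /gen_sylls /=.
set u := syll_act (false, 3) v; rewrite -(syll_actD true) syll_act0.
by rewrite -(syll_actD false) syll_act0.
Qed.

Lemma edge_from_start N u r : edge N Start u r -> u = [:: (GC, 6 * N%:Z)] /\ r = Main 0.
Proof.
move E: Start => p e; case: e E => // {p u r} p u r e E.
by case: e E.
Qed.

Lemma walk_from_start N w q : walk (edge N) Start w q -> q <> Start ->
  exists2 w', walk (edge N) (Main 0) w' q & w = (GC, 6 * N%:Z) :: w'.
Proof.
move E: Start => p W; case: W E => {p w q} [p <- //|p u r w q e W E _].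
by move: e; rewrite -E => /edge_from_start [-> E']; exists w => //; rewrite -E'.
Qed.

Lemma walk_sound N w : walk (edge N) Start w Stop ->
  reduce (content_sylls true w) = [::] -> reduce (content_sylls false w) = [::] ->
  sim_halts 0 N.
Proof.
move=> /walk_from_start [//|w1 /walk_to_stop W ->].
have [w' [T [W' ->]]] := W erefl (ltac:(by [])).
(* The pops invert [clean_sylls T] in both images, so whatever precedes them must equal it. *)
have key first l : reduce (content_sylls first (l ++ pop_content T)) = [::] ->
    reduce (content_sylls first l) = clean_sylls T.
  move=> E; rewrite -[RHS]reduce_id; last by elim: (T) => //= -[|T'].
  apply: reduce_eq => v; rewrite -{1}(pop_clean first T v) -sylls_act_cat.
  by rewrite /content_sylls -map_cat -reduce_act E.
rewrite -cat_cons => /key E1 /key E2.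
exact: (work_walk_sound W' erefl N T E1 E2).
Qed.

(** * Exponent sums and the nontriviality of closed walks *)

Definition sumexp (b : bool) (l : seq syll) : int :=
  \sum_(x <- l | x.1 == b) x.2.

Lemma sumexp_push b x l : sumexp b (push x l) = sumexp b (x :: l).
Proof.
case: x => c e; rewrite /push /= /sumexp; case: eqP => [->|_].
  by rewrite big_cons /=; case: eqP; rewrite ?add0r.
case: l => // -[c' f] l /=; case: eqP => [<-|//]; rewrite !big_cons /=.
case: eqP => [ef|_]; first by case: eqP => // _; rewrite addrA ef add0r.
by rewrite big_cons /=; case: eqP => // _; rewrite addrA.
Qed.

Lemma sumexp_reduce b l : sumexp b (reduce l) = sumexp b l.
Proof.
elim: l => // x l IH; rewrite reduce_cons sumexp_push /sumexp !big_cons.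
by rewrite -!/(sumexp _ _) IH.
Qed.

Definition exps (b : bool) (w : content) : int := sumexp b (content_sylls true w).

Lemma exps_cat b w w' : exps b (w ++ w') = exps b w + exps b w'.
Proof. by rewrite /exps /sumexp /content_sylls map_cat big_cat. Qed.

(** Working edges with no [a^3] either raise the level, from [Back] through [Main] to [Fire], or are
    loops; [drift] is the sign of the exponent sum of [t] along the loop at a state. *)
Definition level (p : state) : nat :=
  match p with Back _ => 1 | Main _ => 2 | Fire _ => 3 | _ => 0 end.

Definition drift (p : state) : int := if p is Back _ then 1 else -1.

Definition working (p : state) : bool :=
  match p with Main _ | Fire _ | Back _ => true | _ => false end.

Hypothesis mod_gt0 : forall i, (i < size rules)%N -> (0 < rule_mod (rule_at i))%N.

Lemma work_edge_exps p u r : work_edge p u r ->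
  0 <= exps true u /\
  (exps true u = 0 -> (level p < level r)%N \/ (p = r /\ 0 < drift p * exps false u)).
Proof.
rewrite /exps /sumexp; case=> [i ii|i ii|i ii|c|c|]; rewrite !big_cons !big_nil /=; split=> //; try by left.
- by right; split=> //; have := mod_gt0 ii; lia.
- by right.
- by right.
Qed.

Lemma walk_exps N p w q : walk (edge N) p w q -> working q ->
  (p <> Pop /\ p <> Stop) /\ (p <> Start ->
  0 <= exps true w /\
  (exps true w = 0 -> (level p < level q)%N \/ (p = q /\ 0 <= drift p * exps false w))).
Proof.
elim=> {p w q} [p|p u r w q e W IH] wq.
  split=> [|_]; first by case: p wq.
  by rewrite /exps /sumexp /content_sylls !big_nil; split=> // _; right; split=> //; lia.
have [[rP rS] IH2] := IH wq.
case: e W {IH} rP rS IH2 => // {p u r} p u r e W rP rS IH.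
have wp : working p by case: e.
have wr : working r by case: e.
split; first by case: (p) wp.
move=> _; have [h1 h2] := work_edge_exps e.
have [|h3 h4] := IH; first by case: (r) wr.
rewrite !exps_cat; split; first by lia.
move=> E; have E1 : exps true u = 0 by lia.
have E2 : exps true w = 0 by lia.
case: (h2 E1) => [l1|[Ep d1]]; case: (h4 E2) => [l2|[Er d2]].
- by left; lia.
- by left; rewrite -Er.
- by left; rewrite Ep.
- by right; split; [rewrite Ep|move: d2; rewrite -Ep mulrDr; lia].
Qed.

Lemma pop_walk_exps N p w q : walk (edge N) p w q -> p = Pop \/ p = Stop -> q = Pop ->
  p = Pop /\ exps true w <= 0.
Proof.
elim=> {p w q} [p|p u r w q e W IH] hp hq.
  by rewrite /exps /sumexp /content_sylls big_nil.
case: e IH hp => {p u r W} [|p u r e|||] IH; try by case.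
- by case: e IH => [i ii|i ii|i ii|c|c|] IH; case.
- case: IH => //; first by left.
  move=> _ h _; split=> //; rewrite exps_cat; have : exps true [:: (GD, - 3); (GA, - 3)] = -3.
    by rewrite /exps /sumexp !big_cons big_nil.
  by lia.
- by case: IH => //; right.
Qed.

(** On working edges the exponent sum of [s] is nonnegative, and positive on [a^3]. If it vanishes
    on a closed working walk, the walk can only repeat loops at one state, and there the exponent
    sum of [t] has a strict sign. At [Pop] the exponent sum of [s] is negative. *)
Lemma walk_cycle N p u r w : edge N p u r -> walk (edge N) r w p -> p <> Start ->
  reduce (content_sylls true (u ++ w)) <> [::].
Proof.
move=> e W pS E.
have z b : exps b (u ++ w) = 0 by rewrite /exps -sumexp_reduce E /sumexp big_nil.
have [z1 z2] := (z true, z false); move: z1 z2; rewrite !exps_cat => z1 z2 {z E}.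
case: e W z1 z2 pS => {p u r} [|p u r e|||] W //.
- move=> z1 z2 _; have wp : working p by case: e {W}.
  have [h1 h2] := walk_exps W wp.
  have wr : r <> Start by case: e {W h1 h2}.
  have [h3 h4] := work_edge_exps e; have [h5 h6] := h2 wr.
  have E1 : exps true u = 0 by lia.
  have E2 : exps true w = 0 by lia.
  case: (h4 E1) => [l1|[Er d1]]; case: (h6 E2) => [l2|[Er' d2]].
  + by lia.
  + by move: l1; rewrite Er' ltnn.
  + by move: l2; rewrite Er ltnn.
  + by move: d2; rewrite Er' -[exps false w](addKr (exps false u)) z2 addr0; lia.
- by have [] := walk_exps W isT; case.
- move=> z1 _ _; have [|//|_ h] := pop_walk_exps W; first by left.
  by move: z1 h; rewrite /exps /sumexp /= !big_cons big_nil /=; lia.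
- by have [|//|] := pop_walk_exps W; first by right.
Qed.

End Automaton.

(** * Actions of the braid group *)

(* A point [(p, v)] with [p < 4] records the position [p] of a distinguished strand; forgetting that strand turns the braid into one on three strands, which acts on the vector [v] through [SL_2(Z)]. At [p >= 4] the braid acts through the homomorphism onto the braid group on three strands that sends the first and third generators to the same one. *)
Definition letter_act (a : letter) (x : nat * vec) : nat * vec :=
  let i := nat_of_ord a.1 in
  let: (p, v) := x in
  if p == i then (i.+1, v) else if p == i.+1 then (i, v) else
  let e : int := (if a.2 then -1 else 1)%R in
  (p, if odd (if i < p <= 3 then i else i.+1) then Umap e v else Vmap e v).

Definition word_act (w : word) (x : nat * vec) : nat * vec := foldr letter_act x w.

Lemma word_act_cat u w x : word_act (u ++ w) x = word_act u (word_act w x).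
Proof. exact: foldr_cat. Qed.

Lemma sig_val i : i < 3 -> nat_of_ord (sig i).1 = i.
Proof. exact: inordK. Qed.

Lemma letter_actK a x : letter_act a (letter_act (linv a) x) = x.
Proof.
case: a x => i b [p [x y]]; rewrite /letter_act /linv /=.
have i3 := ltn_ord i; move: (nat_of_ord i) i3 => {}i i3.
case: (eqVneq p i) => [->|pi] /=.
  by rewrite (_ : (i.+1 == i) = false) ?eqxx //; apply/negP; lia.
case: (eqVneq p i.+1) => [->|pi1] /=; first by rewrite eqxx.
rewrite (negPf pi) (negPf pi1); congr pair.
by case: odd; case: b; rewrite /Umap /Vmap /=; congr pair; ring.
Qed.

Lemma beq_act w w' : beq w w' -> word_act w =1 word_act w'.
Proof.
elim=> {w w'} [//|w w' _ IH x|u w w' _ IH1 _ IH2 x|u v w w' _ IH x|a x|||].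
- by rewrite IH.
- by rewrite IH1.
- by rewrite !word_act_cat IH.
- exact: letter_actK.
- move=> [p [x y]]; rewrite /word_act /= /letter_act !sig_val //=.
  by case: p => [|[|[|[|p]]]] //=; rewrite /Umap /Vmap /=; congr (_, (_, _)); ring.
- move=> [p [x y]]; rewrite /word_act /= /letter_act !sig_val //=.
  by case: p => [|[|[|[|p]]]] //=; rewrite /Umap /Vmap /=; congr (_, (_, _)); ring.
- move=> [p [x y]]; rewrite /word_act /= /letter_act !sig_val //=.
  by case: p => [|[|[|[|p]]]] //=; rewrite /Umap /Vmap /=; congr (_, (_, _)); ring.
Qed.

#[export] Instance beq_equiv : Equivalence beq.
Proof. by split=> [w|w w'|w1 w2 w3]; [apply: beq_refl|apply: beq_sym|apply: beq_trans]. Qed.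

#[export] Instance beq_cat : Proper (beq ==> beq ==> beq) (@cat letter).
Proof.
move=> u u' hu w w' hw; apply: (@beq_trans _ (u' ++ w)).
  exact: (beq_ctx [::] w hu).
by have := beq_ctx u' [::] hw; rewrite !cats0.
Qed.

Definition winv (w : word) : word := rev (map linv w).

Lemma winv_cons a w : winv (a :: w) = winv w ++ [:: linv a].
Proof. by rewrite /winv /= rev_cons cats1. Qed.

Lemma linvK : involutive linv.
Proof. by case=> i b; rewrite /linv /= negbK. Qed.

Lemma beq_mulwV w : beq (w ++ winv w) [::].
Proof.
elim: w => [|a w IH]; first exact: beq_refl.
rewrite winv_cons -cat1s -!catA (catA w) IH cat0s; exact: beq_cancel.
Qed.

Lemma winvK : involutive winv.
Proof.
by move=> w; rewrite /winv map_rev revK -map_comp -[RHS]map_id; apply: eq_map => a; rewrite /= linvK.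
Qed.

Lemma beq_mulVw w : beq (winv w ++ w) [::].
Proof. by rewrite -{2}(winvK w); exact: beq_mulwV. Qed.

Definition gen_word (g : gen) : word :=
  match g with
  | GA => [:: sig 1; sig 1]
  | GB => flatten (nseq 6 [:: sig 0; sig 1])
  | GC => [:: sig 0; sig 0]
  | GD => [:: sig 2; sig 2]
  end.

Definition gen_pow (x : gen * int) : word :=
  flatten (nseq `|x.2|%N (if (x.2 < 0)%R then winv (gen_word x.1) else gen_word x.1)).

Definition content_word (l : content) : word := flatten (map gen_pow l).

Lemma content_word_cat l l' : content_word (l ++ l') = content_word l ++ content_word l'.
Proof. by rewrite /content_word map_cat flatten_cat. Qed.

Definition base_pos (first : bool) : nat := if first then 4 else 0.

Section WordAction.
Local Open Scope ring_scope.

(** The full twist [(s1 s2)^3] acts as [-1] under the resolvent map, which is why [b] is its square.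
    Without the first strand it becomes the full twist on two strands, namely [s], so [b] becomes
    [s^2]. *)
Lemma full_twist_act first x y :
  word_act (flatten (nseq 3 [:: sig 0; sig 1])) (base_pos first, (x, y)) =
  (base_pos first, if first then (- x, - y) else (x, y - 2 * x)).
Proof.
by case: first; rewrite /word_act /= /letter_act !sig_val //= /Umap /Vmap /=; congr (_, (_, _)); ring.
Qed.

Lemma gen_word_act first g v :
  word_act (gen_word g) (base_pos first, v) = (base_pos first, syll_act (gen_sylls first (g, 1)) v).
Proof.
case: v => x y; case: g.
2: rewrite (_ : gen_word GB = flatten (nseq 3 [:: sig 0; sig 1]) ++ flatten (nseq 3 [:: sig 0; sig 1])) //.
2: rewrite word_act_cat full_twist_act; case: first; rewrite full_twist_act.
2,3: by rewrite /syll_act /gen_sylls /Umap /Vmap /=; congr (_, (_, _)); ring.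
all: case: first; rewrite /word_act /= /letter_act !sig_val //=;
  by rewrite /syll_act /gen_sylls /Umap /Vmap /=; congr (_, (_, _)); ring.
Qed.

Lemma winv_act w p f g : (forall v, word_act w (p, v) = (p, f v)) -> cancel g f ->
  forall v, word_act (winv w) (p, v) = (p, g v).
Proof.
move=> hw fg v; rewrite -{1}(fg v) -hw -word_act_cat.
exact: (beq_act (beq_mulVw w)).
Qed.

Lemma gen_sylls_opp first g e : gen_sylls first (g, - e) = syll_inv (gen_sylls first (g, e)).
Proof. by case: g; case: first; rewrite /gen_sylls /syll_inv /= ?mulrN ?oppr0. Qed.

Lemma gen_sylls_act0 first g v : syll_act (gen_sylls first (g, 0)) v = v.
Proof. by case: g; case: first; rewrite /gen_sylls /= ?mulr0 syll_act0. Qed.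

Lemma gen_sylls_actD first g e f v : syll_act (gen_sylls first (g, e + f)) v =
  syll_act (gen_sylls first (g, e)) (syll_act (gen_sylls first (g, f)) v).
Proof. by case: g; case: first; rewrite /gen_sylls /= ?mulrDr -syll_actD ?addr0. Qed.

Lemma gen_pow_act first x v :
  word_act (gen_pow x) (base_pos first, v) = (base_pos first, syll_act (gen_sylls first x) v).
Proof.
case: x => g e; rewrite /gen_pow /=.
pose s : int := if e < 0 then -1 else 1.
have h u : word_act (if e < 0 then winv (gen_word g) else gen_word g) (base_pos first, u) =
    (base_pos first, syll_act (gen_sylls first (g, s)) u).
  rewrite /s; case: (e < 0) => /=; last exact: gen_word_act.
  rewrite gen_sylls_opp.
  exact: (winv_act (g := syll_act _) (gen_word_act first g) (syll_Kinv _)).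
rewrite [in RHS](_ : e = s * `|e|%N%:Z); last by rewrite /s; case: (boolP (e < 0)) => ?; lia.
elim: `|e|%N => [|n IH]; first by rewrite mulr0 gen_sylls_act0.
rewrite /= word_act_cat IH h; congr pair.
by rewrite -gen_sylls_actD; congr (syll_act (gen_sylls first (g, _)) v); lia.
Qed.

Lemma content_word_act first l v :
  word_act (content_word l) (base_pos first, v) =
  (base_pos first, sylls_act (content_sylls first l) v).
Proof. by elim: l => //= x l IH; rewrite /content_word /= word_act_cat IH gen_pow_act. Qed.

Lemma content_beq_reduce first l l' : beq (content_word l) (content_word l') ->
  reduce (content_sylls first l) = reduce (content_sylls first l').
Proof.
move=> /beq_act E; apply: reduce_eq => v.
by have := E (base_pos first, v); rewrite !content_word_act => -[].
Qed.

End WordAction.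

(** * Products of generators and the soundness of the reduction *)

Definition arrow := (state * content * state)%type.

Section Submonoid.
Local Open Scope ring_scope.

Definition content_inv (w : content) : content := rev (map (fun x : gen * int => (x.1, - x.2)) w).

Definition key_content (p : state) : content :=
  match p with
  | Start => [:: (GA, 1); (GD, 1); (GA, -1); (GD, -1)]
  | Stop => [::]
  | _ => [:: (GA, key_exp p); (GD, 1); (GA, key_exp p); (GD, 1)]
  end.

Definition arrow_content (x : arrow) : content :=
  let: (p, u, q) := x in key_content p ++ u ++ content_inv (key_content q).

Definition arrow_word (x : arrow) : word := content_word (arrow_content x).

Definition arrows_content (l : seq arrow) : content := flatten (map arrow_content l).

Lemma flatten_arrow_word l : flatten (map arrow_word l) = content_word (arrows_content l).
Proof. by elim: l => //= x l IH; rewrite IH /arrows_content /= content_word_cat. Qed.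

Lemma content_sylls_cat first w w' :
  content_sylls first (w ++ w') = content_sylls first w ++ content_sylls first w'.
Proof. exact: map_cat. Qed.

Lemma content_sylls_inv first w :
  content_sylls first (content_inv w) = sylls_inv (content_sylls first w).
Proof.
rewrite /content_sylls /content_inv /sylls_inv map_rev -!map_comp; congr rev.
by apply: eq_map => -[g e] /=; rewrite gen_sylls_opp.
Qed.

Lemma content_sylls_key first p : content_sylls first (key_content p) = key_sylls p.
Proof. by case: p. Qed.

Lemma arrow_sylls first p w q : content_sylls first (arrow_content (p, w, q)) =
  segment_sylls (p, content_sylls first w, q).
Proof. by rewrite /arrow_content !content_sylls_cat content_sylls_inv !content_sylls_key. Qed.

Section Soundness.
Variables (rules : seq rule) (halt N : nat).
Hypothesis mod_gt0 : forall i, (i < size rules)%N -> (0 < rule_mod (rule_at rules i))%N.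

Let E := edge rules halt N.

Definition is_arrow (x : arrow) : Prop := let: (p, u, q) := x in E p u q.

Fixpoint all_arrows (l : seq arrow) : Prop := if l is x :: l' then is_arrow x /\ all_arrows l' else True.

(** The walk is required to have a first edge, since an empty walk would be a closed segment with
    trivial content. *)
Definition is_segment (x : arrow) : Prop :=
  let: (p, w, q) := x in exists u r w', [/\ E p u r, walk E r w' q & w = u ++ w'].

Fixpoint segments (l : seq arrow) : Prop :=
  if l is (p, w, q) :: l' then
    [/\ is_segment (p, w, q), (if l' is (p', _, _) :: _ then p' <> q else True) & segments l']
  else True.

(** Where an arrow ends in the state in which the next segment starts, the inverse key and the key
    between them cancel and the two are fused. *)
Lemma arrows_segments l : all_arrows l -> exists2 l', segments l' &
  forall first, reduce (content_sylls first (arrows_content l')) =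
                reduce (content_sylls first (arrows_content l)).
Proof.
elim: l => [|[[p u] q] l IH] /=; first by exists [::].
case=> e /IH [l' sl El].
have step first : reduce (content_sylls first (arrows_content ((p, u, q) :: l))) =
  pushs (content_sylls first (arrow_content (p, u, q))) (reduce (content_sylls first (arrows_content l'))).
  by rewrite El -reduce_cat -content_sylls_cat.
case: l' sl El step => [|[[p' w] q'] l'] sl El step.
  exists [:: (p, u, q)] => [|first]; last by rewrite step -reduce_cat -content_sylls_cat.
  by split=> //; exists u, q, [::]; split=> //; [apply: walk_nil|rewrite cats0].
case: (eqVneq (state_index p') (state_index q)) => [/state_index_inj pq|/eqP npq].
  move: sl => /= [[u' [r [w' [e' W Ew]]]] j sl].
  exists ((p, u ++ w, q') :: l') => [|first].
    split=> //; exists u, q, w; split=> //.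
    by rewrite Ew -pq; apply: walk_cons e' W.
  rewrite step {step El} -reduce_cat -content_sylls_cat pq.
  rewrite /arrows_content /= !content_sylls_cat !content_sylls_inv -!catA.
  rewrite ![reduce (_ ++ _)]reduce_cat -!/(pushs _ _); congr pushs; congr pushs.
  by rewrite -[LHS](pushs_invK (content_sylls first (key_content q))) // !pushs_reduced // reduce_reduced.
exists [:: (p, u, q), (p', w, q') & l'] => [|first].
  split=> //; first by exists u, q, [::]; split=> //; [apply: walk_nil|rewrite cats0].
  by move=> pq; apply: npq; rewrite pq.
by rewrite step -reduce_cat -content_sylls_cat.
Qed.

Lemma edge_source p u r : E p u r -> p <> Stop.
Proof. by case=> // {p u r} p u r []. Qed.

Lemma edge_target p u r : E p u r -> r <> Start.
Proof. by case=> // {p u r} p u r []. Qed.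

Lemma walk_target p w q : walk E p w q -> p <> Start -> q <> Start.
Proof. by elim=> {p w q} // p u r w q e _ IH _; apply/IH/(edge_target e). Qed.

Lemma edge_mult3 first p u r : E p u r -> mult3 (content_sylls first u).
Proof.
case=> [|{p u r}p u r e|||]; try by case: first => //=; rewrite /mult3 /=; lia.
by case: e => [i ii|i ii|i ii|c|c|]; case: first; rewrite /mult3 /=; lia.
Qed.

Lemma walk_mult3 first p w q : walk E p w q -> mult3 (content_sylls first w).
Proof.
elim=> {p w q} // p u r w q e _ IH.
by rewrite content_sylls_cat /mult3 all_cat -!/(mult3 _) IH (edge_mult3 _ e).
Qed.

Lemma segments_prop p w q : is_segment (p, w, q) ->
  [/\ p <> Stop, q <> Start & forall first, mult3 (content_sylls first w)].
Proof.
case=> u [r [w' [e W ->]]]; split=> [||first].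
- exact: edge_source e.
- exact: walk_target W (edge_target e).
- by rewrite content_sylls_cat /mult3 all_cat -!/(mult3 _) (walk_mult3 _ W) (edge_mult3 _ e).
Qed.

Definition to_segment (first : bool) (x : arrow) : segment :=
  (x.1.1, content_sylls first x.1.2, x.2).

Lemma chain_arrows first l :
  chain_sylls (map (to_segment first) l) = content_sylls first (arrows_content l).
Proof.
rewrite /chain_sylls /arrows_content /content_sylls map_flatten -!map_comp; congr flatten.
by apply: eq_map => -[[p w] q]; rewrite [RHS](arrow_sylls first p w q).
Qed.

Lemma segments_chain l : segments l -> chain (map (to_segment true) l).
Proof.
elim: l => // -[[p w] q] l IH [sg j sl] /=.
have [pS qS m3] := segments_prop sg; split=> //; last first.
  by split; [case: (l) j => // -[[]]|exact: IH].
move=> pq; case: sg => u [r [w' [e W Ew]]]; rewrite Ew; apply: (walk_cycle mod_gt0 e).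
  by rewrite pq.
by rewrite pq.
Qed.

(** Closed walks are controlled only under [psi_1]. But [psi_1] has by now shown that every segment
    runs from [Start] to [Stop], so under [psi_2] the condition on closed segments holds
    vacuously. *)
Lemma segments_chain_false l : segments l -> chain_trivial (map (to_segment true) l) ->
  chain (map (to_segment false) l).
Proof.
elim: l => // -[[p w] q] l IH [sg j sl] /= [pS qS _ tl].
have [_ _ m3] := segments_prop sg.
split=> //; rewrite ?pS ?qS //; split; last exact: IH.
by case: (l) tl => // -[[p' w'] q'] l' [] /= ->.
Qed.

Lemma gamma_pow_word k : flatten (nseq k gamma0) = content_word (flatten (nseq k (key_content Start))).
Proof. by elim: k => //= k ->; rewrite (content_word_cat (key_content Start)). Qed.

Lemma gamma_pow_sylls_word first k :
  content_sylls first (flatten (nseq k (key_content Start))) = gamma_pow_sylls k.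
Proof. by rewrite /content_sylls map_flatten map_nseq -/(content_sylls _ _) content_sylls_key. Qed.

(** A positive power of [gamma0] is nontrivial, so there is at least one segment; the first is a
    complete run whose content is trivial in both images, and [walk_sound] applies to it. *)
Lemma product_sound l k : all_arrows l ->
  beq (flatten (map arrow_word l)) (flatten (nseq k.+1 gamma0)) -> sim_halts rules halt 0 N.
Proof.
move=> /arrows_segments [l' sl El]; rewrite flatten_arrow_word gamma_pow_word => B.
have key first : reduce (chain_sylls (map (to_segment first) l')) = reduce (gamma_pow_sylls k.+1).
  by rewrite chain_arrows El (content_beq_reduce first B) gamma_pow_sylls_word.
have c1 := segments_chain sl.
have t1 := chain_control c1 (key true).
have t2 := chain_control (segments_chain_false sl t1) (key false).
case: l' sl key t1 t2 {El c1} => [|[[p w] q] l'] sl key.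
  have [rk [|]] := gamma_pow_keyed k.+1; first by [].
  by move: (key true); rewrite (reduce_id rk) => <- [y [s]].
move=> /= [pS qS w1 _] [_ _ w2 _]; case: sl => [[u [r [w' [e W Ew]]]] _ _].
apply: (walk_sound (w := w)) => //; rewrite Ew -pS -qS; exact: walk_cons e W.
Qed.

End Soundness.
End Submonoid.

(** * From computations to braid words *)

Section Completeness.
#[local] Hint Resolve beq_refl : core.
Local Open Scope ring_scope.

Definition feq (l l' : content) : Prop := beq (content_word l) (content_word l').

#[local] Instance feq_equiv : Equivalence feq.
Proof.
split=> [l|l l'|l1 l2 l3]; rewrite /feq; first by reflexivity.
  by move=> h; symmetry.
by move=> h1 h2; rewrite h1.
Qed.

#[local] Instance feq_cat : Proper (feq ==> feq ==> feq) (@cat (gen * int)).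
Proof. by move=> u u' hu w w' hw; rewrite /feq !content_word_cat; exact: (beq_cat hu hw). Qed.

Lemma content_word1 x : content_word [:: x] = gen_pow x.
Proof. by rewrite /content_word /= cats0. Qed.

Lemma beq_cancel_l u w w' : beq (u ++ w) (u ++ w') -> beq w w'.
Proof.
by move=> h; rewrite -[w]cat0s -(beq_mulVw u) -catA h catA beq_mulVw.
Qed.

Lemma gen_powS g (e : int) : beq (gen_pow (g, e + 1)) (gen_word g ++ gen_pow (g, e)).
Proof.
rewrite /gen_pow /=; case: (boolP (e < 0)) => h.
  have -> : absz e = (absz (e + 1)%R).+1 by lia.
  rewrite /= catA beq_mulwV cat0s.
  case: (boolP (e + 1 < 0)) => h'; first by reflexivity.
  by have -> : absz (e + 1)%R = 0%N by lia.
have -> : (e + 1 < 0) = false by apply/negP; lia.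
by have -> : absz (e + 1)%R = (absz e).+1 by lia.
Qed.

Lemma feq_add g (e f : int) : feq [:: (g, e); (g, f)] [:: (g, e + f)].
Proof.
rewrite /feq -cat1s content_word_cat !content_word1.
elim/int_ind: e => [|n IH|n IH]; first by rewrite add0r.
- rewrite (_ : n.+1%:Z = n%:Z + 1); last by lia.
  by rewrite gen_powS -catA IH -gen_powS (_ : n%:Z + 1 + f = n%:Z + f + 1) //; lia.
- have h := gen_powS g (- n.+1%:Z); rewrite (_ : - n.+1%:Z + 1 = - n%:Z) in h; last by lia.
  have h' := gen_powS g (- n.+1%:Z + f); rewrite (_ : - n.+1%:Z + f + 1 = - n%:Z + f) in h'; last by lia.
  by apply: (@beq_cancel_l (gen_word g)); rewrite catA -h IH h'.
Qed.

Definition commute (u w : word) : Prop := beq (u ++ w) (w ++ u).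

Lemma commute_sym u w : commute u w -> commute w u.
Proof. by rewrite /commute => h; symmetry. Qed.

Lemma commute_cat u w w' : commute u w -> commute u w' -> commute u (w ++ w').
Proof. by rewrite /commute => h h'; rewrite catA h -catA h' catA. Qed.

Lemma commute_nseq u w n : commute u w -> commute u (flatten (nseq n w)).
Proof.
move=> h; elim: n => [|n IH] /=; first by rewrite /commute cats0.
exact: commute_cat.
Qed.

Lemma commute_inv u w : commute u w -> commute u (winv w).
Proof.
rewrite /commute => h.
by rewrite -[u ++ _]cat0s -(beq_mulVw w) -!catA (catA w u) -h -catA beq_mulwV cats0.
Qed.

Lemma commute_pow u g e : commute u (gen_word g) -> commute u (gen_pow (g, e)).
Proof. by move=> h; apply: commute_nseq => /=; case: ifP => // _; apply: commute_inv. Qed.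

Lemma feq_commute g h e f : commute (gen_word g) (gen_word h) ->
  feq [:: (g, e); (h, f)] [:: (h, f); (g, e)].
Proof.
move=> c; rewrite /feq -[[:: _; _]]/([:: (g, e)] ++ [:: (h, f)]) -[[:: (h, f); _]]/([:: (h, f)] ++ [:: (g, e)]).
rewrite !content_word_cat !content_word1.
exact: (commute_pow _ (commute_sym (commute_pow _ (commute_sym c)))).
Qed.

(* In the braid group on three strands [(s t)^2 t = s (s t)^2] and [(s t) s = t (s t)], so [(s t)^3] is central. *)
Lemma commute_full_twist i : (i = 0 \/ i = 1)%N ->
  commute [:: sig i] (flatten (nseq 3 [:: sig 0; sig 1])).
Proof.
pose s := [:: sig 0]; pose t := [:: sig 1]; pose x := [:: sig 0; sig 1].
have hs : beq (x ++ s) (t ++ x) by exact: beq_rel12.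
have ht : beq (x ++ x ++ t) (s ++ x ++ x) by exact: (beq_ctx s t (beq_sym beq_rel12)).
case=> ->; apply/beq_sym.
- apply: (@beq_trans _ (x ++ x ++ t ++ x)).
    exact: (beq_cat (beq_refl x) (beq_cat (beq_refl x) hs)).
  exact: (beq_cat ht (beq_refl x)).
- apply: (@beq_trans _ (x ++ s ++ x ++ x)).
    exact: (beq_cat (beq_refl x) ht).
  exact: (beq_cat hs (beq_refl (x ++ x))).
Qed.

Lemma commute_square i w : commute [:: sig i] w -> commute [:: sig i; sig i] w.
Proof. by move=> h; have h' := commute_sym h; exact: commute_sym (commute_cat h' h'). Qed.

Lemma commute_AB : commute (gen_word GA) (gen_word GB).
Proof.
have h := commute_square (commute_full_twist (or_intror (erefl 1%N))).
exact: (commute_cat h h).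
Qed.

Lemma commute_CB : commute (gen_word GC) (gen_word GB).
Proof.
have h := commute_square (commute_full_twist (or_introl (erefl 0%N))).
exact: (commute_cat h h).
Qed.

Lemma commute_CD : commute (gen_word GC) (gen_word GD).
Proof.
apply: commute_square; have h : commute [:: sig 0] [:: sig 2] := beq_rel13.
exact: (commute_cat h h).
Qed.

Lemma feq_bc_add x y c b :
  feq [:: (GC, x); (GB, y); (GC, c); (GB, b)] [:: (GC, x + c); (GB, y + b)].
Proof.
transitivity ([:: (GC, x)] ++ [:: (GC, c); (GB, y)] ++ [:: (GB, b)]).
  rewrite -(feq_commute y c (commute_sym commute_CB)); reflexivity.
transitivity ([:: (GC, x); (GC, c)] ++ [:: (GB, y); (GB, b)]); first reflexivity.
by rewrite !feq_add; reflexivity.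
Qed.

Lemma feq_nseq k u u' : feq u u' -> feq (flatten (nseq k u)) (flatten (nseq k u')).
Proof. by move=> h; elim: k => [|k IH] /=; [reflexivity|exact: (feq_cat h IH)]. Qed.

Lemma feq_bc_loop x y c b k :
  feq ([:: (GC, x); (GB, y)] ++ flatten (nseq k [:: (GC, c); (GB, b)]))
      [:: (GC, x + c * k%:Z); (GB, y + b * k%:Z)].
Proof.
elim: k x y => [|k IH] x y; first by rewrite !mulr0 !addr0; reflexivity.
transitivity ([:: (GC, x); (GB, y); (GC, c); (GB, b)] ++ flatten (nseq k [:: (GC, c); (GB, b)])).
  by reflexivity.
rewrite feq_bc_add IH (_ : x + c + c * k%:Z = x + c * k.+1%:Z); last by lia.
by rewrite (_ : y + b + b * k%:Z = y + b * k.+1%:Z); [reflexivity|lia].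
Qed.

Definition clean_content (T : nat) : content := flatten (nseq T [:: (GA, 3); (GD, 3)]).

Lemma clean_content_rcons T : clean_content T.+1 = clean_content T ++ [:: (GA, 3); (GD, 3)].
Proof. by elim: T => // T IH; exact: (congr1 (cat [:: (GA, 3); (GD, 3)]) IH). Qed.

Lemma feq_cancel2 g h e f : feq [:: (g, e); (h, f); (h, - f); (g, - e)] [::].
Proof.
transitivity ([:: (g, e)] ++ [:: (h, f); (h, - f)] ++ [:: (g, - e)]); first reflexivity.
rewrite feq_add addrN; transitivity [:: (g, e); (g, - e)]; first exact: beq_refl.
by rewrite feq_add addrN; exact: beq_refl.
Qed.

Lemma clean_pop T : feq (clean_content T ++ pop_content T) [::].
Proof.
elim: T => [|T IH]; first reflexivity.
rewrite clean_content_rcons -catA.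
rewrite -[_ ++ pop_content T.+1]/([:: (GA, 3); (GD, 3); (GD, - 3); (GA, - 3)] ++ pop_content T).
by rewrite feq_cancel2.
Qed.

Section Arrows.
Variables (rules : seq rule) (halt : nat).

Definition rule_arrows (i : nat) : seq arrow :=
  let r := rule_at rules i in
  [:: (Main (rule_src r), [:: (GC, - (6 * (rule_rem r)%:Z)); (GB, 3 * (rule_add r)%:Z)], Fire i);
      (Fire i, [:: (GC, - (6 * (rule_mod r)%:Z)); (GB, 3 * (rule_mul r)%:Z)], Fire i);
      (Fire i, [:: (GA, 3)], Back (rule_dst r));
      (Back (rule_dst r), [:: (GB, - 3); (GC, 6)], Back (rule_dst r));
      (Back (rule_dst r), [:: (GD, 3)], Main (rule_dst r))].

Definition arrows : seq arrow :=
  flatten (map rule_arrows (iota 0 (size rules))) ++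
  [:: (Main halt, [:: (GC, - 6)], Main halt); (Main halt, [::], Pop);
      (Pop, [:: (GD, - 3); (GA, - 3)], Pop); (Pop, [::], Stop)].

Definition start_arrow (N : nat) : arrow := (Start, [:: (GC, 6 * N%:Z)], Main 0).

Fixpoint inlist (T : Type) (x : T) (l : seq T) : Prop :=
  if l is y :: l' then y = x \/ inlist x l' else False.

Lemma inlist_cat (T : Type) (x : T) l l' : inlist x (l ++ l') <-> inlist x l \/ inlist x l'.
Proof. elim: l => [|y l IH] /=; tauto. Qed.

Lemma inlist_iota x m n : inlist x (iota m n) <-> (m <= x < m + n)%N.
Proof.
elim: n m => [|n IH] m /=; first by split=> //; lia.
by rewrite IH; split=> [[<-|]|h]; lia.
Qed.

Lemma inlist_flatten_map (S T : Type) (f : S -> seq T) x l :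
  inlist x (flatten (map f l)) <-> exists2 i, inlist i l & inlist x (f i).
Proof.
elim: l => [|y l IH] /=; first by split=> // -[].
rewrite inlist_cat IH; split=> [[h|[i h1 h2]]|[i [<-|h1] h2]].
- by exists y => //; left.
- by exists i => //; right.
- by left.
- by right; exists i.
Qed.

Lemma arrows_edge N x : inlist x (start_arrow N :: arrows) -> is_arrow rules halt N x.
Proof.
case=> [<-|/inlist_cat [/inlist_flatten_map [i /inlist_iota /andP [_ ii] h]|h]].
- exact: edge_start.
- by case: h => [<-|[<-|[<-|[<-|[<-|[]]]]]]; apply: edge_work; constructor.
- case: h => [<-|[<-|[<-|[<-|[]]]]]; first by apply: edge_work; constructor.
  + exact: edge_end.
  + exact: edge_pop.
  + exact: edge_stop.
Qed.

Let E (p : state) (u : content) (q : state) : Prop := inlist (p, u, q) arrows.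

Lemma rule_arrows_in i x : (i < size rules)%N -> inlist x (rule_arrows i) -> inlist x arrows.
Proof.
by move=> ii h; apply/inlist_cat; left; apply/inlist_flatten_map; exists i => //; apply/inlist_iota.
Qed.

Lemma walk_loop p u w q k : E p u p -> walk E p w q -> walk E p (flatten (nseq k u) ++ w) q.
Proof.
move=> e W; elim: k => //= k IH; rewrite -catA; exact: walk_cons e IH.
Qed.

(** [T] counts the blocks closed so far. It must be quantified inside the induction, since each
    simulated step closes one more block and only the final pops use the number. *)
Lemma sim_walk c n : sim_halts rules halt c n -> forall T,
  exists2 w, walk E (Main c) w Stop & feq (clean_content T ++ [:: (GC, 6 * n%:Z)] ++ w) [::].
Proof.
elim=> {c n} [n|i k ii _ IH] T.
  exists (flatten (nseq n [:: (GC, - 6)]) ++ [::] ++ flatten (nseq T [:: (GD, - 3); (GA, - 3)]) ++ [::] ++ [::]).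
    have hE x : inlist x [:: (Main halt, [:: (GC, - 6)], Main halt); (Main halt, [::], Pop);
      (Pop, [:: (GD, - 3); (GA, - 3)], Pop); (Pop, [::], Stop)] -> inlist x arrows.
      by move=> h; apply/inlist_cat; right.
    apply: walk_loop; first by apply: hE; left.
    apply: (@walk_cons _ _ _ Pop); first by apply: hE; right; left.
    apply: walk_loop; first by apply: hE; right; right; left.
    apply: (@walk_cons _ _ _ Stop); first by apply: hE; right; right; right; left.
    exact: walk_nil.
  have h : feq ([:: (GC, 6 * n%:Z)] ++ flatten (nseq n [:: (GC, - 6)])) [::].
    elim: (n) => [|m IH]; first exact: beq_refl.
    rewrite -[_ ++ _]/([:: (GC, 6 * m.+1%:Z); (GC, - 6)] ++ flatten (nseq m [:: (GC, - 6)])).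
    by rewrite feq_add (_ : 6 * m.+1%:Z + - 6 = 6 * m%:Z) //; lia.
  by rewrite !cat0s !cats0 (catA [:: (GC, _)]) h cat0s; exact: clean_pop.
set r := rule_at rules i in IH *; set m := (rule_mul r * k + rule_add r)%N in IH.
have [w W F] := IH T.+1.
have hE x : inlist x (rule_arrows i) -> inlist x arrows by exact: rule_arrows_in.
exists ([:: (GC, - (6 * (rule_rem r)%:Z)); (GB, 3 * (rule_add r)%:Z)] ++
  flatten (nseq k [:: (GC, - (6 * (rule_mod r)%:Z)); (GB, 3 * (rule_mul r)%:Z)]) ++
  [:: (GA, 3)] ++ flatten (nseq m [:: (GB, - 3); (GC, 6)]) ++ [:: (GD, 3)] ++ w).
  apply: (@walk_cons _ _ _ (Fire i)); first by apply: hE; left.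
  apply: walk_loop; first by apply: hE; right; left.
  apply: (@walk_cons _ _ _ (Back (rule_dst r))); first by apply: hE; right; right; left.
  apply: walk_loop; first by apply: hE; right; right; right; left.
  apply: (@walk_cons _ _ _ (Main (rule_dst r))); first by apply: hE; right; right; right; right; left.
  exact: W.
have F1 : feq ([:: (GC, 6 * (rule_mod r * k + rule_rem r)%N%:Z)] ++
    [:: (GC, - (6 * (rule_rem r)%:Z)); (GB, 3 * (rule_add r)%:Z)] ++
    flatten (nseq k [:: (GC, - (6 * (rule_mod r)%:Z)); (GB, 3 * (rule_mul r)%:Z)]))
    [:: (GB, 3 * m%:Z)].
  rewrite catA -[[:: (GC, _)] ++ _]/([:: (GC, _); (GC, _)] ++ [:: (GB, _)]) feq_add.
  rewrite -[_ ++ [:: (GB, _)]]/[:: (GC, _); (GB, _)] feq_bc_loop.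
  rewrite [X in (GC, X)](_ : _ = 0); last by lia.
  rewrite [X in (GB, X)](_ : _ = 3 * m%:Z); last by rewrite /m; lia.
  exact: beq_refl.
have F2 : feq ([:: (GB, 3 * m%:Z)] ++ flatten (nseq m [:: (GB, - 3); (GC, 6)])) [:: (GC, 6 * m%:Z)].
  transitivity ([:: (GC, 0); (GB, 3 * m%:Z)] ++ flatten (nseq m [:: (GC, 6); (GB, - 3)])).
    have h0 : feq [:: (GB, 3 * m%:Z)] [:: (GC, 0); (GB, 3 * m%:Z)] by exact: beq_refl.
    exact: (feq_cat h0 (feq_nseq m (feq_commute (- 3) 6 (commute_sym commute_CB)))).
  rewrite feq_bc_loop add0r [X in (GB, X)](_ : _ = 0); last by lia.
  exact: beq_refl.
have FA : feq ([:: (GB, 3 * m%:Z)] ++ [:: (GA, 3)]) ([:: (GA, 3)] ++ [:: (GB, 3 * m%:Z)]).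
  exact: (feq_commute _ _ (commute_sym commute_AB)).
have FD : feq ([:: (GC, 6 * m%:Z)] ++ [:: (GD, 3)]) ([:: (GD, 3)] ++ [:: (GC, 6 * m%:Z)]).
  exact: (feq_commute _ _ commute_CD).
move: F1 F2; set ent := [:: (GC, _); (GB, _)]; set loop := flatten _; set back := flatten _ => F1 F2.
set c0 := [:: (GC, _)] in F1 *; set a3 := [:: (GA, 3)] in FA *; set d3 := [:: (GD, 3)] in FD *.
set b1 := [:: (GB, _)] in F1 F2 FA *; set c1 := [:: (GC, _)] in F F2 FD *.
transitivity (clean_content T ++ (c0 ++ ent ++ loop) ++ a3 ++ back ++ d3 ++ w).
  by rewrite -!catA; reflexivity.
rewrite F1 (catA b1) FA -(catA a3) (catA b1) F2 (catA c1) FD.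
transitivity (clean_content T.+1 ++ c1 ++ w); last exact: F.
by rewrite clean_content_rcons -!catA; reflexivity.
Qed.

Lemma content_word_inv w : beq (content_word (content_inv w) ++ content_word w) [::].
Proof.
elim: w => [|[g e] w IH]; first exact: beq_refl.
rewrite /content_inv /= rev_cons -cats1 -/(content_inv w) content_word_cat -catA.
rewrite -[(g, e) :: w]cat1s content_word_cat (catA (content_word [:: _])) -content_word_cat.
have h : feq [:: (g, - e); (g, e)] [::] by rewrite feq_add addNr; exact: beq_refl.
by rewrite (h : beq _ _) cat0s IH.
Qed.

(** The product telescopes: at each intermediate state an inverse key meets its key. *)
Lemma walk_product p w q : walk E p w q -> exists2 l, (forall x, inlist x l -> inlist x arrows) &
  beq (flatten (map arrow_word l)) (content_word (key_content p ++ w ++ content_inv (key_content q))).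
Proof.
have invR u : beq (content_word u ++ content_word (content_inv u)) [::].
  have {1}-> : u = content_inv (content_inv u); last exact: content_word_inv.
  rewrite /content_inv map_rev revK -map_comp -[LHS]map_id.
  by apply: eq_map => -[g e] /=; rewrite opprK.
elim=> {p w q} [p|p u r w q e _ [l lin B]].
  by exists [::] => //; rewrite cat0s content_word_cat invR.
exists ((p, u, r) :: l) => [x [<- //|]|/=]; first exact: lin.
rewrite B /arrow_word /arrow_content !content_word_cat -!catA (catA (content_word (content_inv _))).
by rewrite content_word_inv cat0s.
Qed.

Definition arrow_words : seq word := map arrow_word arrows.
Definition start_word (N : nat) : word := arrow_word (start_arrow N).

Lemma mem_map_inlist (T : Type) (U : eqType) (f : T -> U) x l : inlist x l -> f x \in map f l.
Proof.
by elim: l => //= y l IH [->|/IH h]; rewrite in_cons ?eqxx // h orbT.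
Qed.

Lemma inlist_mem_map (T : Type) (U : eqType) (f : T -> U) y l :
  y \in map f l -> exists2 x, inlist x l & y = f x.
Proof.
elim: l => //= x l IH; rewrite in_cons => /orP [/eqP ->|/IH [z h ->]].
  by exists x => //; left.
by exists z => //; right.
Qed.

Lemma sim_halts_product N : sim_halts rules halt 0 N ->
  exists2 ws, all (fun x => x \in arrow_words) ws & beq (start_word N ++ flatten ws) gamma0.
Proof.
move=> /sim_walk/(_ 0) [w W F]; have [l lin B] := walk_product W.
exists (map arrow_word l).
  apply/allP => y /inlist_mem_map [x hx ->]; apply: mem_map_inlist; exact: lin.
rewrite B /start_word /arrow_word /start_arrow /arrow_content -content_word_cat.
set key0 := key_content (Main 0); set c := [:: (GC, _)] in F *.
have I : feq (content_inv key0 ++ key0) [::] by rewrite /feq content_word_cat content_word_inv.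
rewrite -[gamma0]/(content_word (key_content Start)) -/(feq _ _) cats0.
transitivity (key_content Start ++ c ++ (content_inv key0 ++ key0) ++ w).
  by rewrite -(catA (key_content Start)) -(catA c) -(catA (content_inv key0)); reflexivity.
by rewrite I cat0s (F : feq (c ++ w) [::]) cats0; reflexivity.
Qed.

(** The solution of [start_word N * x = gamma0]. Moving the only generator that depends on [N] to
    the other side leaves a fixed generating set, as the first claim requires. *)
Definition target_word (N : nat) : word :=
  content_word (key_content (Main 0) ++ [:: (GC, - (6 * N%:Z))]).

Lemma start_target N : beq (start_word N ++ target_word N) gamma0.
Proof.
rewrite /start_word /target_word /arrow_word /arrow_content -content_word_cat.
rewrite -[gamma0]/(content_word (key_content Start)) -/(feq _ _).
set key0 := key_content (Main 0); set c := [:: (GC, 6 * N%:Z)]; set c' := [:: (GC, _)].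
have I : feq (content_inv key0 ++ key0) [::] by rewrite /feq content_word_cat content_word_inv.
have I' : feq (c ++ c') [::] by have := feq_add GC (6 * N%:Z) (- (6 * N%:Z)); rewrite addrN.
transitivity (key_content Start ++ c ++ (content_inv key0 ++ key0) ++ c').
  by rewrite -(catA (key_content Start)) -(catA c) -(catA (content_inv key0)); reflexivity.
by rewrite I cat0s I' cats0; reflexivity.
Qed.

Lemma product_sim_halts N k ws :
  (forall i, (i < size rules)%N -> (0 < rule_mod (rule_at rules i))%N) ->
  all (fun x => x \in start_word N :: arrow_words) ws ->
  beq (flatten ws) (flatten (nseq k.+1 gamma0)) -> sim_halts rules halt 0 N.
Proof.
move=> mod0 inX; have [l lin ->] : exists2 l, all_arrows rules halt N l & ws = map arrow_word l.
  elim: ws inX => [|x ws IH] /=; first by exists [::].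
  rewrite -[start_word N :: _]/(map arrow_word (start_arrow N :: arrows)).
  case/andP=> /inlist_mem_map [y /arrows_edge hy ->] /IH [l lin ->].
  by exists (y :: l).
exact: product_sound.
Qed.

End Arrows.
End Completeness.

(** * Functions computable by register machines *)

Definition regs := (nat -> nat).

(* Code fragments are parametrised by the address at which they are loaded, since jumps are absolute. *)
Definition code := (nat -> program).

Definition reach (P : program) (s s' : rstate) : Prop := exists k, rm_exec P k s = s'.

Lemma reach_refl P s : reach P s s.
Proof. by exists 0. Qed.

Lemma rm_execD P k l s : rm_exec P (k + l) s = rm_exec P k (rm_exec P l s).
Proof. exact: iterD. Qed.

Lemma reach_trans P s1 s2 s3 : reach P s1 s2 -> reach P s2 s3 -> reach P s1 s3.
Proof. by move=> [k h] [l h']; exists (l + k); rewrite rm_execD h. Qed.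

Lemma reach_step P s s' : rm_step P s = s' -> reach P s s'.
Proof. by exists 1. Qed.

Definition runs (c : code) (R R' : regs) : Prop := forall pre post,
  reach (pre ++ c (size pre) ++ post) (size pre, R) (size pre + size (c (size pre)), R').

Lemma rm_step_at pre i post R :
  rm_step (pre ++ i :: post) (size pre, R) =
  match i with
  | INC r => ((size pre).+1, upd R r (R r).+1)
  | DEC r j => if R r == 0 then (j, R) else ((size pre).+1, upd R r (R r).-1)
  end.
Proof. by rewrite /rm_step size_cat /= nth_cat ltnn subnn /= leqNgt addnS ltnS leq_addr. Qed.

Definition cskip : code := fun _ => [::].
Definition cinc (r : nat) : code := fun _ => [:: INC r].
Definition cdec (r : nat) : code := fun o => [:: DEC r o.+1].
Definition cseq (c1 c2 : code) : code := fun o => c1 o ++ c2 (o + size (c1 o)).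

(* Register [z] must be zero at the end of the body, which makes [DEC z o] an unconditional jump back. *)
Definition cloop (r z : nat) (c : code) : code := fun o =>
  DEC r (o + size (c o.+1)).+2 :: c o.+1 ++ [:: DEC z o].

Lemma runs_skip R : runs cskip R R.
Proof. by move=> pre post; rewrite addn0; apply: reach_refl. Qed.

Lemma runs_inc r R : runs (cinc r) R (upd R r (R r).+1).
Proof. by move=> pre post; apply: reach_step; rewrite rm_step_at addn1. Qed.

Lemma upd_id R r : upd R r (R r) = R.
Proof. by apply: functional_extensionality => x; rewrite /upd; case: eqP => [->|]. Qed.

Lemma runs_dec r R : runs (cdec r) R (upd R r (R r).-1).
Proof.
move=> pre post; apply: reach_step; rewrite rm_step_at addn1.
case: eqP => // E; congr pair; apply: functional_extensionality => x.
by rewrite /upd; case: eqP => // ->; rewrite E.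
Qed.

Lemma runs_seq c1 c2 R1 R2 R3 : runs c1 R1 R2 -> runs c2 R2 R3 -> runs (cseq c1 c2) R1 R3.
Proof.
move=> h1 h2 pre post; rewrite /cseq -catA; apply: reach_trans (h1 pre _) _.
have := h2 (pre ++ c1 (size pre)) post.
by rewrite !size_cat -!catA addnA.
Qed.

(** [S i] describes the registers at the loop test when [i] passes remain. *)
Lemma runs_loop r z c (S : nat -> regs) n :
  (forall i, i <= n -> S i r = i) ->
  (forall i, i < n -> runs c (upd (S i.+1) r i) (S i)) ->
  (forall i, i < n -> S i z = 0) -> runs (cloop r z c) (S n) (S 0).
Proof.
move=> Sr body Sz pre post; rewrite /cloop.
set o := size pre; set P := pre ++ _.
have first R : rm_step P (o, R) =
    if R r == 0 then ((o + size (c o.+1)).+2, R) else (o.+1, upd R r (R r).-1).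
  by rewrite /P cat_cons rm_step_at.
have sz : size (DEC r (o + size (c o.+1)).+2 :: c o.+1 ++ [:: DEC z o]) = (size (c o.+1)).+2.
  by rewrite /= size_cat addn1.
rewrite sz !addnS; move: Sr body Sz; elim: n => [|n IH] Sr body Sz.
  by apply: reach_step; rewrite first Sr.
apply: reach_trans (IH _ _ _); last 3 first.
- by move=> i hi; apply: Sr; lia.
- by move=> i hi; apply: body; lia.
- by move=> i hi; apply: Sz; lia.
apply: (reach_trans (reach_step (first _))); rewrite Sr //=.
have := body n (ltnSn n) (rcons pre (DEC r (o + size (c o.+1)).+2)) (DEC z o :: post).
rewrite size_rcons -/o cat_rcons => h.
have EP : pre ++ DEC r (o + size (c o.+1)).+2 :: c o.+1 ++ DEC z o :: post = P.
  by rewrite /P /= -catA.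
move: h; rewrite EP => h; apply: (reach_trans h); apply: reach_step.
have EP2 : (pre ++ DEC r (o + size (c o.+1)).+2 :: c o.+1) ++ DEC z o :: post = P.
  by rewrite -EP -catA.
have EO : o.+1 + size (c o.+1) = size (pre ++ DEC r (o + size (c o.+1)).+2 :: c o.+1).
  by rewrite size_cat /= -/o; lia.
by rewrite -EP2 EO rm_step_at Sz.
Qed.

Lemma runs_ext c R R' R'' : runs c R R' -> R' =1 R'' -> runs c R R''.
Proof. by move=> h E; rewrite -(functional_extensionality _ _ E). Qed.

Ltac upd_tac := move=> x; rewrite /upd; repeat case: eqP => ?; subst; lia.

Definition cclear (r z : nat) : code := cloop r z cskip.

Lemma runs_clear r z R : r != z -> R z = 0 -> runs (cclear r z) R (upd R r 0).
Proof.
move=> rz Rz; have := @runs_loop r z cskip (fun i => upd R r i) (R r).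
rewrite upd_id; apply.
- by move=> i _; rewrite /upd eqxx.
- move=> i _; apply: (runs_ext (@runs_skip _)); upd_tac.
- by move=> i _; rewrite /upd eq_sym (negPf rz).
Qed.

Definition cmove (a b z : nat) : code := cloop a z (cinc b).

Lemma runs_move a b z R : a != b -> a != z -> b != z -> R z = 0 -> R b = 0 ->
  runs (cmove a b z) R (upd (upd R a 0) b (R a)).
Proof.
move=> ab az bz Rz Rb.
have := @runs_loop a z (cinc b) (fun i => upd (upd R a i) b (R a - i)) (R a).
have -> : upd (upd R a (R a)) b (R a - R a) = R.
  by rewrite subnn -Rb upd_id upd_id.
rewrite subn0; apply.
- by move=> i _; rewrite /upd (negPf ab) eqxx.
- move=> i hi; apply: (runs_ext (@runs_inc _ _)).
  by move=> x; rewrite /upd; repeat case: eqP => ?; subst; lia.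
- by move=> i _; rewrite /upd ![z == _]eq_sym (negPf az) (negPf bz).
Qed.

Definition ccopy (a d : nat) : code :=
  cseq (cloop a d.+2 (cseq (cinc d) (cinc d.+1))) (cmove d.+1 a d.+2).

Lemma runs_copy a d R : a < d -> (forall j, d <= j -> R j = 0) ->
  runs (ccopy a d) R (upd R d (R a)).
Proof.
move=> ad R0.
have h0 := R0 d (leqnn d); have h1 := R0 d.+1 (leqnSn d); have h2 : R d.+2 = 0 by apply: R0; lia.
apply: (@runs_seq _ _ _ (upd (upd (upd R a 0) d (R a)) d.+1 (R a))).
  have := @runs_loop a d.+2 (cseq (cinc d) (cinc d.+1))
    (fun i => upd (upd (upd R a i) d (R a - i)) d.+1 (R a - i)) (R a).
  rewrite (_ : upd (upd (upd R a (R a)) d (R a - R a)) d.+1 (R a - R a) = R); last first.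
    by apply: functional_extensionality; upd_tac.
  rewrite subn0; apply.
  - by move=> i _; rewrite /upd; case: eqP => ?; [lia|case: eqP => ?; [lia|rewrite eqxx]].
  - move=> i hi; apply: (runs_seq (@runs_inc _ _)); apply: (runs_ext (@runs_inc _ _)).
    by move=> x; rewrite /upd; repeat case: eqP => ?; subst; lia.
  - by move=> i _; rewrite /upd; repeat case: eqP => ?; subst; lia.
have := @runs_move d.+1 a d.+2 (upd (upd (upd R a 0) d (R a)) d.+1 (R a)).
move=> h; apply: (runs_ext (h _ _ _ _ _)); try lia.
- by rewrite /upd; repeat case: eqP => ?; subst; lia.
- by rewrite /upd; repeat case: eqP => ?; subst; lia.
- by move=> x; rewrite /upd; repeat case: eqP => ?; subst; lia.
Qed.

(* The code computing [f] finds its arguments in the registers listed by [rho], all below the depth [d], and leaves its value in register [d]; the registers from [d] on serve as a stack. *)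
Definition computable (k : nat) (f : seq nat -> nat) : Prop :=
  exists c : seq nat -> nat -> code, forall rho d R,
    size rho = k -> all (fun j => j < d) rho -> (forall j, d <= j -> R j = 0) ->
    runs (c rho d) R (upd R d (f (map R rho))).

Lemma computable_ext k f g : (forall v, size v = k -> f v = g v) -> computable k f -> computable k g.
Proof.
move=> E [c h]; exists c => rho d R sr ar R0.
by rewrite -E ?size_map //; apply: h.
Qed.

Lemma computable_var k i : i < k -> computable k (fun v => nth 0 v i).
Proof.
move=> ik; exists (fun rho d => ccopy (nth 0 rho i) d) => rho d R sr ar R0.
rewrite (nth_map 0) ?sr //; apply: runs_copy => //.
by move/all_nthP: ar; apply; rewrite sr.
Qed.

Lemma computable_zero k : computable k (fun _ => 0).
Proof.
exists (fun _ _ => cskip) => rho d R _ _ R0; apply: (runs_ext (@runs_skip _)) => x.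
by rewrite /upd; case: eqP => // ->; rewrite R0.
Qed.

Lemma computable_succ k f : computable k f -> computable k (fun v => (f v).+1).
Proof.
move=> [c h]; exists (fun rho d => cseq (c rho d) (cinc d)) => rho d R sr ar R0.
apply: (runs_seq (h _ _ _ sr ar R0)); apply: (runs_ext (@runs_inc _ _)); upd_tac.
Qed.

Lemma computable_pred k f : computable k f -> computable k (fun v => (f v).-1).
Proof.
move=> [c h]; exists (fun rho d => cseq (c rho d) (cdec d)) => rho d R sr ar R0.
apply: (runs_seq (h _ _ _ sr ar R0)); apply: (runs_ext (@runs_dec _ _)); upd_tac.
Qed.

Lemma map_upd R d y rho : all (fun j => j < d) rho -> map (upd R d y) rho = map R rho.
Proof.
move=> /allP h; apply/eq_in_map => j /h; rewrite /upd.
by case: eqP => // ->; rewrite ltnn.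
Qed.

Lemma all_lt_trans d d' (rho : seq nat) : d <= d' -> all (fun j => j < d) rho -> all (fun j => j < d') rho.
Proof. by move=> dd; apply: sub_all => j /leq_trans; apply. Qed.

Definition creturn (d : nat) : code := cseq (cclear d d.+2) (cmove d.+1 d d.+2).

Lemma runs_return d R : R d.+2 = 0 -> runs (creturn d) R (upd (upd R d.+1 0) d (R d.+1)).
Proof.
move=> R2; apply: (runs_seq (@runs_clear d d.+2 R _ R2)); first by lia.
apply: (runs_ext (@runs_move d.+1 d d.+2 (upd R d 0) _ _ _ _ _)); try lia.
- by rewrite /upd; repeat case: eqP => ?; subst; lia.
- by rewrite /upd; repeat case: eqP => ?; subst; lia.
- upd_tac.
Qed.

Lemma computable_let k f g : computable k f -> computable k.+1 g ->
  computable k (fun v => g (f v :: v)).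
Proof.
move=> [c h] [c' h'].
exists (fun rho d => cseq (c rho d) (cseq (c' (d :: rho) d.+1) (creturn d))) => rho d R sr ar R0.
apply: (runs_seq (h _ _ _ sr ar R0)).
set R1 := upd R d _.
have R10 j : d.+1 <= j -> R1 j = 0.
  by move=> hj; rewrite /R1 /upd; case: eqP => [|_]; [lia|apply: R0; lia].
have E1 : R1 d = f (map R rho) by rewrite /R1 /upd eqxx.
have := h' (d :: rho) d.+1 R1 _ _ R10; rewrite /= sr ltnSn => /(_ erefl).
rewrite (all_lt_trans (leqnSn d) ar) => /(_ isT) H; apply: (runs_seq H).
apply: (runs_ext (@runs_return _ _ _)).
  by rewrite /upd; case: eqP => [|_]; [lia|apply: R10; lia].
have E2 : map R1 rho = map R rho by exact: map_upd.
rewrite E1 E2 => x; rewrite {1 2}/upd; case: (x =P d) => [->|ne].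
  by rewrite /upd !eqxx.
case: (x =P d.+1) => [->|ne'].
  by rewrite /upd; case: eqP => [|_]; [lia|rewrite R0].
rewrite /R1 /upd; repeat case: eqP => ?; subst; lia.
Qed.

Lemma computable_rename m k g (s : seq nat) : size s = m -> all (fun i => i < k) s ->
  computable m g -> computable k (fun v => g (map (nth 0 v) s)).
Proof.
move=> ss /allP sk [c h]; exists (fun rho d => c (map (nth 0 rho) s) d) => rho d R sr ar R0.
have -> : map (nth 0 (map R rho)) s = map R (map (nth 0 rho) s).
  by rewrite -map_comp; apply/eq_in_map => i /sk ik /=; rewrite (nth_map 0) ?sr.
apply: h => //; rewrite ?size_map //.
by apply/allP => j /mapP [i /sk ik ->]; move/all_nthP: ar; apply; rewrite sr.
Qed.

Fixpoint iter_down (s : nat -> nat -> nat) (n acc : nat) : nat :=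
  if n is n'.+1 then iter_down s n' (s acc n') else acc.

(** Register [d] holds the number of passes left, [d.+1] the accumulator, and the body works on the
    stack from [d.+2] on. In the proof [acc j] is the accumulator after [j] passes, so [S i]
    contains [acc (N - i)]. *)
Lemma computable_iter k n b s : computable k n -> computable k b -> computable k.+2 s ->
  computable k (fun v => iter_down (fun acc i => s [:: acc, i & v]) (n v) (b v)).
Proof.
move=> [cn hn] [cb hb] [cs hs].
exists (fun rho d => cseq (cn rho d) (cseq (cb rho d.+1)
   (cseq (cloop d d.+3 (cseq (cs [:: d.+1, d & rho] d.+2) (creturn d.+1))) (cmove d.+1 d d.+2)))) => rho d R sr ar R0.
have R00 := R0 d (leqnn d).
apply: (runs_seq (hn _ _ _ sr ar R0)).
set N := n (map R rho); set R1 := upd R d N.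
have R10 j : d.+1 <= j -> R1 j = 0.
  by move=> hj; rewrite /R1 /upd; case: eqP => [|_]; [lia|apply: R0; lia].
apply: (runs_seq (hb _ _ _ sr (all_lt_trans (leqnSn d) ar) R10)).
rewrite map_upd //; set B := b (map R rho).
pose body acc i := s [:: acc, i & map R rho].
pose acc := fix acc j := if j is j'.+1 then body (acc j') (N - j'.+1) else B.
pose S i := upd (upd R d i) d.+1 (acc (N - i)).
have E0 : upd R1 d.+1 B = S N by rewrite /S subnn.
have EN : acc N = iter_down body N B.
  have gen j : j <= N -> iter_down body N B = iter_down body (N - j) (acc j).
    elim: j => [|j IH] hj; first by rewrite subn0.
    by rewrite IH ?(ltnW hj) // (_ : N - j = (N - j.+1).+1) //; lia.
  by rewrite (gen N) // subnn.
rewrite E0; apply: (@runs_seq _ _ _ (S 0)).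
  apply: runs_loop => [i hi|i hi|i hi].
  - by rewrite /S /upd; repeat case: eqP => ?; lia.
  - pose R2 := upd (S i.+1) d i; have R20 j : d.+2 <= j -> R2 j = 0.
      move=> hj; rewrite /R2 /S /upd; do 2 (case: eqP => [|_]; first by lia).
      by apply: R0; lia.
    have := hs [:: d.+1, d & rho] d.+2 R2 _ _ R20; rewrite /= sr => /(_ erefl).
    rewrite !leqnn /= ltnW // (all_lt_trans _ ar) // => [/(_ isT) H|]; last by lia.
    apply: (runs_seq H); apply: (runs_ext (@runs_return _ _ _)).
      by rewrite /upd; case: eqP => [|_]; [lia|apply: R20; lia].
    have -> : [:: R2 d.+1, R2 d & map R2 rho] = [:: acc (N - i.+1), i & map R rho].
      congr [:: _, _ & _]; rewrite /R2 /S.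
      - by rewrite /upd; repeat case: eqP => ?; lia.
      - by rewrite /upd; repeat case: eqP => ?; lia.
      - by rewrite !map_upd // (all_lt_trans (leqnSn d) ar).
    rewrite -/(body _ _) => x.
    have Ei : acc (N - i) = body (acc (N - i.+1)) i.
      by rewrite (_ : N - i = (N - i.+1).+1) /=; [congr (body _ _); lia|lia].
    rewrite /S Ei; move: (body _ _) => V.
    have R02 : R d.+2 = 0 by apply: R0; lia.
    rewrite /R2 /S /upd; case: (x =P d.+1) => // ?; first by subst; rewrite eqxx.
    by repeat case: eqP => ?; subst; lia.
  - by rewrite /S /upd; do 2 (case: eqP => [|_]; first by lia); apply: R0; lia.
apply: (runs_ext (@runs_move _ _ _ _ _ _ _ _ _)); try lia.
- by rewrite /S /upd; do 2 (case: eqP => [|_]; first by lia); apply: R0; lia.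
- by rewrite /S /upd; repeat case: eqP => ?; lia.
have R01 := R0 d.+1 (leqnSn d).
rewrite -EN => x; rewrite /S subn0; move: (acc N) => V.
by rewrite /upd; repeat case: eqP => ?; subst; lia.
Qed.

Definition computable1 (F : nat -> nat) : Prop := computable 1 (fun v => F (nth 0 v 0)).
Definition computable2 (F : nat -> nat -> nat) : Prop :=
  computable 2 (fun v => F (nth 0 v 0) (nth 0 v 1)).

Lemma computable_app1 F k f : computable1 F -> computable k f -> computable k (fun v => F (f v)).
Proof.
move=> hF hf.
have := @computable_rename 1 k.+1 _ [:: 0] erefl isT hF; exact: computable_let hf.
Qed.

Lemma computable_weaken k f : computable k f -> computable k.+1 (fun v => f (behead v)).
Proof.
move=> hf; have := @computable_rename k k.+1 f (iota 1 k) (size_iota _ _) _ hf.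
move=> H; apply: (computable_ext _ (H _)) => [v sv|].
  congr f; apply: (@eq_from_nth _ 0) => [|i]; first by rewrite size_map size_iota size_behead sv.
  by rewrite size_map size_iota => ik; rewrite (nth_map 0) ?size_iota // nth_iota // nth_behead.
by apply/allP => i; rewrite mem_iota; lia.
Qed.

Lemma computable_app2 F k f g : computable2 F -> computable k f -> computable k g ->
  computable k (fun v => F (f v) (g v)).
Proof.
move=> hF hf hg.
have h := @computable_rename 2 k.+2 _ [:: 1; 0] erefl isT hF.
exact: (computable_let hf (computable_let (computable_weaken hg) h)).
Qed.

Lemma computable_const k n : computable k (fun _ => n).
Proof. by elim: n => [|n IH]; [exact: computable_zero|exact: computable_succ]. Qed.

Lemma computable_comp F G : computable1 F -> computable1 G -> computable1 (fun n => F (G n)).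
Proof. exact: computable_app1. Qed.

Lemma computable1_ext F G : F =1 G -> computable1 F -> computable1 G.
Proof. by move=> E; apply: computable_ext => v _; rewrite E. Qed.

Lemma iter_down_sum g n b : iter_down (fun acc i => acc + g i) n b = b + \sum_(i < n) g i.
Proof.
by elim: n b => [|n IH] b /=; rewrite ?big_ord0 ?addn0 // IH big_ord_recr /=; lia.
Qed.

Lemma computable_add : computable2 addn.
Proof.
have := @computable_iter 2 (fun v => nth 0 v 0) (fun v => nth 0 v 1) (fun v => (nth 0 v 0).+1)
  (computable_var (ltn0Sn 1)) (computable_var (ltnSn 1)) (computable_succ (computable_var (ltn0Sn 3))).
apply: computable_ext => v _ /=.
by move: (nth 0 v 0) (nth 0 v 1) => x; elim: x => //= x IH y; rewrite IH addnS.
Qed.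

Lemma computable_sub : computable2 subn.
Proof.
have := @computable_iter 2 (fun v => nth 0 v 1) (fun v => nth 0 v 0) (fun v => (nth 0 v 0).-1)
  (computable_var (ltnSn 1)) (computable_var (ltn0Sn 1)) (computable_pred (computable_var (ltn0Sn 3))).
apply: computable_ext => v _ /=.
by move: (nth 0 v 0) (nth 0 v 1) => x y; elim: y x => [|y IH] x /=; rewrite ?subn0 // IH; lia.
Qed.

Lemma computable_mul : computable2 muln.
Proof.
have := @computable_iter 2 (fun v => nth 0 v 0) (fun _ => 0) (fun v => nth 0 v 0 + nth 0 v 3)
  (computable_var (ltn0Sn 1)) (computable_zero 2)
  (computable_app2 computable_add (computable_var (ltn0Sn 3)) (computable_var (ltnSn 3))).
apply: computable_ext => v _ /=.
by rewrite (iter_down_sum (fun _ => nth 0 v 1)) sum_nat_const card_ord.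
Qed.

Lemma computable_exp2 : computable1 (fun n => 2 ^ n).
Proof.
have := @computable_iter 1 (fun v => nth 0 v 0) (fun _ => 1) (fun v => nth 0 v 0 + nth 0 v 0)
  (computable_var (ltn0Sn 0)) (computable_const 1 1)
  (computable_app2 computable_add (computable_var (ltn0Sn 2)) (computable_var (ltn0Sn 2))).
apply: computable_ext => v _ /=; move: (nth 0 v 0) => n.
suff E b : iter_down (fun acc _ => acc + acc) n b = b * 2 ^ n by rewrite E mul1n.
by elim: n b => [|n IH] b /=; [rewrite muln1|rewrite IH expnS mulnA addnn muln2].
Qed.

Lemma computable_leq : computable2 (fun x y => (x <= y)).
Proof.
have := computable_app2 computable_sub (computable_const 2 1) computable_sub.
by apply: computable_ext => v _ /=; move: (nth 0 v 0) (nth 0 v 1) => x y; case: leqP => h; lia.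
Qed.

(** An iteration whose body ignores the accumulator: zero passes leave the value of [g], any
    positive number of passes gives that of [f]. *)
Lemma computable_if k c f g : computable k c -> computable k f -> computable k g ->
  computable k (fun v => if c v == 0 then g v else f v).
Proof.
move=> hc hf hg.
have := @computable_iter k c g (fun v => f (behead (behead v))) hc hg
  (computable_weaken (computable_weaken hf)).
by apply: computable_ext => v _ /=; case: (c v) => //= n; elim: n.
Qed.

(** * Cantor pairing, its inverse, and division *)

Definition tri (s : nat) : nat := \sum_(i < s) i.+1.

Lemma triE s : tri s = (s * s.+1) %/ 2.
Proof.
rewrite /tri; have : (\sum_(i < s) i.+1) * 2 = s * s.+1.
  by elim: s => [|s IH]; rewrite ?big_ord0 // big_ord_recr /= mulnDl IH; lia.
by move=> <-; rewrite mulnK.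
Qed.

Lemma triS s : tri s.+1 = tri s + s.+1.
Proof. by rewrite /tri big_ord_recr. Qed.

Lemma computable_tri : computable1 tri.
Proof.
have := @computable_iter 1 (fun v => nth 0 v 0) (fun _ => 0) (fun v => nth 0 v 0 + (nth 0 v 1).+1)
  (computable_var (ltn0Sn 0)) (computable_zero 1)
  (computable_app2 computable_add (computable_var (ltn0Sn 2)) (computable_succ (computable_var (isT : 1 < 3)))).
by apply: computable_ext => v _ /=; rewrite (iter_down_sum succn).
Qed.

Lemma cpairE x y : cpair x y = tri (x + y) + y.
Proof. by rewrite /cpair triE. Qed.

Lemma computable_cpair : computable2 cpair.
Proof.
have h0 := @computable_var 2 0 isT; have h1 := @computable_var 2 1 isT.
have := computable_app2 computable_add (computable_app1 computable_tri computable_add) h1.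
by apply: computable_ext => v _; rewrite cpairE.
Qed.

(** The largest [s] with [tri s <= z], obtained by counting so that [computable_iter] applies
    without a search. *)
Definition tri_root (z : nat) : nat := \sum_(i < z) (tri i.+1 <= z).
Definition unpair2 (z : nat) : nat := z - tri (tri_root z).
Definition unpair1 (z : nat) : nat := tri_root z - unpair2 z.

Lemma tri_mono : {homo tri : x y / x <= y}.
Proof. by move=> x y; elim: y => [|y IH]; [case: x|rewrite leq_eqVlt triS => /orP [/eqP ->|/IH]; rewrite ?triS; lia]. Qed.

Lemma leq_tri s : s <= tri s.
Proof. by case: s => // s; rewrite triS; lia. Qed.

Lemma sum_ltn z s : \sum_(i < z) (i < s) = minn z s.
Proof. by elim: z => [|z IH]; rewrite ?big_ord0 ?min0n // big_ord_recr /= IH; lia. Qed.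

Lemma tri_rootE x y : tri_root (cpair x y) = x + y.
Proof.
rewrite /tri_root cpairE.
under eq_bigr => i _.
  rewrite (_ : (_ <= _) = (i < x + y)); first over.
  apply/idP/idP => [h|h]; last by have := tri_mono h; lia.
  rewrite ltnNge; apply/negP => h'; have := tri_mono (h' : (x + y).+1 <= i.+1); rewrite triS; lia.
by rewrite sum_ltn; have := leq_tri (x + y); lia.
Qed.

Lemma unpair2E x y : unpair2 (cpair x y) = y.
Proof. by rewrite /unpair2 tri_rootE cpairE; lia. Qed.

Lemma unpair1E x y : unpair1 (cpair x y) = x.
Proof. by rewrite /unpair1 unpair2E tri_rootE; lia. Qed.

Lemma computable_tri_root : computable1 tri_root.
Proof.
have := @computable_iter 1 (fun v => nth 0 v 0) (fun _ => 0)
  (fun v => nth 0 v 0 + (tri (nth 0 v 1).+1 <= nth 0 v 2))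
  (computable_var (ltn0Sn 0)) (computable_zero 1)
  (computable_app2 computable_add (@computable_var 3 0 isT)
    (computable_app2 computable_leq
      (computable_app1 computable_tri (computable_succ (@computable_var 3 1 isT))) (@computable_var 3 2 isT))).
by apply: computable_ext => v _ /=; rewrite (iter_down_sum (fun i => tri i.+1 <= nth 0 v 0)).
Qed.

Lemma computable_unpair2 : computable1 unpair2.
Proof.
exact: (computable_app2 computable_sub (@computable_var 1 0 isT)
  (computable_app1 computable_tri computable_tri_root)).
Qed.

Lemma computable_unpair1 : computable1 unpair1.
Proof. exact: (computable_app2 computable_sub computable_tri_root computable_unpair2). Qed.

(* Junk at [p = 0]: the value is then [n]. *)
Definition quotient (n p : nat) : nat := \sum_(i < n) (i.+1 * p <= n).

Lemma quotientE n p : 0 < p -> quotient n p = n %/ p.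
Proof.
move=> p0; rewrite /quotient; under eq_bigr => i _ do rewrite -leq_divRL //.
by rewrite sum_ltn; have := leq_div n p; lia.
Qed.

Lemma computable_quotient : computable2 quotient.
Proof.
have := @computable_iter 2 (fun v => nth 0 v 0) (fun _ => 0)
  (fun v => nth 0 v 0 + ((nth 0 v 1).+1 * nth 0 v 3 <= nth 0 v 2))
  (@computable_var 2 0 isT) (computable_zero 2)
  (computable_app2 computable_add (@computable_var 4 0 isT)
    (computable_app2 computable_leq
      (computable_app2 computable_mul (computable_succ (@computable_var 4 1 isT)) (@computable_var 4 3 isT))
      (@computable_var 4 2 isT))).
by apply: computable_ext => v _ /=; rewrite (iter_down_sum (fun i => i.+1 * nth 0 v 1 <= nth 0 v 0)).
Qed.

(** * Halting, and programs built from other programs *)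

Definition init_regs (n : nat) : regs := fun r => if r == 0 then n else 0.

Definition rm_halts (P : program) (n : nat) : Prop :=
  exists k, size P <= (rm_exec P k (rm_init n)).1.

Lemma rm_step_halted P s : size P <= s.1 -> rm_step P s = s.
Proof. by case: s => pc R /= h; rewrite h. Qed.

Lemma rm_exec_halted P k l s : size P <= (rm_exec P k s).1 -> k <= l -> rm_exec P l s = rm_exec P k s.
Proof.
move=> h kl; rewrite -(subnK kl) rm_execD; elim: (l - k) => //= n IH.
by rewrite /rm_exec /= -/(rm_exec _ _ _) IH rm_step_halted.
Qed.

Lemma not_rm_halts P n : (forall k, exists2 l, k <= l & (rm_exec P l (rm_init n)).1 < size P) ->
  ~ rm_halts P n.
Proof.
move=> h [k hk]; have [l kl hl] := h k.
by move: hl; rewrite (rm_exec_halted hk kl) ltnNge hk.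
Qed.

Lemma computable_code f : computable1 f -> exists c : code, forall n,
  runs c (init_regs n) (upd (init_regs n) 1 (f n)).
Proof.
move=> [c h]; exists (c [:: 0] 1) => n.
by have := h [:: 0] 1 (init_regs n) erefl isT; apply; case.
Qed.

Lemma computable_program f : computable1 f -> exists c : code, forall n,
  runs c (init_regs n) (init_regs (f n)).
Proof.
move=> /computable_code [c h]; exists (cseq c (creturn 0)) => n.
apply: (runs_seq (h n)); apply: (runs_ext (@runs_return _ _ _)) => //.
by case=> [|[|x]].
Qed.

(** Jumps beyond the end of [D] are redirected to its end, so that halting of [D] becomes falling
    through to the code behind it. *)
Definition creloc (D : program) : code := fun o =>
  map (fun i => if i is DEC r j then DEC r (o + minn j (size D)) else i) D.

Lemma runs_creloc D R k : size D <= (rm_exec D k (0, R)).1 ->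
  runs (creloc D) R (rm_exec D k (0, R)).2.
Proof.
move=> hk pre post; set o := size pre; set P := pre ++ _.
have sim l : reach P (o, R) (o + minn (rm_exec D l (0, R)).1 (size D), (rm_exec D l (0, R)).2).
  elim: l => [|l IH]; first by rewrite min0n addn0; apply: reach_refl.
  apply: (reach_trans IH); rewrite {2 3}/rm_exec /= -/(rm_exec _ _ _).
  case: (rm_exec D l (0, R)) => pc R1 /=.
  case: (leqP (size D) pc) => [h|h] /=; first by rewrite (minn_idPr h); apply: reach_refl.
  have E : P = (pre ++ take pc (creloc D o)) ++ nth (INC 0) (creloc D o) pc :: (drop pc.+1 (creloc D o) ++ post).
    by rewrite -cat_cons -drop_nth ?size_map // -catA (catA (take _ _)) cat_take_drop.
  have Eo : o + pc = size (pre ++ take pc (creloc D o)).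
    by rewrite size_cat size_take size_map h.
  apply: reach_step; rewrite E Eo rm_step_at -Eo (nth_map (INC 0)) //.
  case: (nth _ _ _) => [r|r j] /=; first by rewrite (minn_idPl h) addnS.
  by case: eqP => _ //; rewrite (minn_idPl h) addnS.
have := sim k; rewrite (minn_idPr hk) => h.
by rewrite /creloc size_map.
Qed.

Lemma runs_program c R R' : runs c R R' -> reach (c 0) (0, R) (size (c 0), R').
Proof. by move=> /(_ [::] [::]); rewrite cat0s cats0 add0n. Qed.

(** Two instructions are appended to the decider: on answer 0 the first jumps out of the program; on
    answer 1 it clears the register and passes to the second, which jumps to itself forever. *)
Lemma decider_flip f D : computable1 f -> exists Q : program, forall n,
  (rm_halts_with D (f n) 0 -> rm_halts Q n) /\ (rm_halts_with D (f n) 1 -> ~ rm_halts Q n).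
Proof.
move=> /computable_program [c h].
pose tail : code := fun o => [:: DEC 0 o.+2; DEC 0 o.+1].
pose body := cseq c (creloc D); set L := size (body 0).
have EQ : cseq body tail 0 = body 0 ++ [:: DEC 0 L.+2; DEC 0 L.+1] by [].
have stp R : rm_step (cseq body tail 0) (L, R) =
    if R 0 == 0 then (L.+2, R) else (L.+1, upd R 0 (R 0).-1).
  by rewrite EQ rm_step_at.
have stp' R : R 0 = 0 -> rm_step (cseq body tail 0) (L.+1, R) = (L.+1, R).
  move=> R0; rewrite EQ -cat_rcons.
  by have := rm_step_at (rcons (body 0) (DEC 0 L.+2)) (DEC 0 L.+1) [::] R; rewrite size_rcons R0.
exists (cseq body tail 0) => n.
have key m : rm_halts_with D (f n) m -> exists R, reach (cseq body tail 0) (rm_init n) (L, R) /\ R 0 = m.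
  move=> [k /= [hk <-]]; exists (rm_exec D k (rm_init (f n))).2; split=> //.
  by have := runs_seq (h n) (runs_creloc hk) [::] (tail L).
split=> /key [R [[k Ek] R0]].
  exists k.+1; rewrite /rm_exec /= -/(rm_exec _ _ _) Ek stp R0 /= EQ size_cat /=; lia.
have R1 : upd R 0 (R 0).-1 0 = 0 by rewrite /upd R0.
have loop l : rm_exec (cseq body tail 0) (l + k.+1) (rm_init n) = (L.+1, upd R 0 (R 0).-1).
  elim: l => [|l IH]; first by rewrite /rm_exec /= -/(rm_exec _ _ _) Ek stp R0.
  by rewrite /rm_exec /= -/(rm_exec _ _ _) IH stp'.
apply: not_rm_halts => l; exists (l + k.+1); first by lia.
by rewrite loop EQ size_cat /=; lia.
Qed.

Lemma program_of_iteration step test : computable1 step -> computable1 test ->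
  exists U : program, forall x, rm_halts U x <-> exists k, test (iter k step x) <> 0.
Proof.
move=> /computable_program [cs hs] /computable_code [ct ht].
pose T := ct 0; pose a := size T; pose F := cs a.+2.
pose e := (a.+2 + size F).+1.
(* Register 1 receives the test value: if it is 0, control skips to the step code, otherwise it
   falls to [DEC 2 e] and leaves. Register 2 is always 0, so [DEC 2] is an unconditional jump. *)
pose U := T ++ [:: DEC 1 a.+2, DEC 2 e & F ++ [:: DEC 2 0]].
have sU : size U = e by rewrite /U !size_cat /= size_cat /= /e; lia.
have rT x : reach U (0, init_regs x) (a, upd (init_regs x) 1 (test x)) by exact: (ht x [::]).
have s1 R : rm_step U (a, R) = if R 1 == 0 then (a.+2, R) else (a.+1, upd R 1 (R 1).-1).
  by rewrite /U rm_step_at.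
have s2 R : R 2 = 0 -> rm_step U (a.+1, R) = (e, R).
  move=> R2; rewrite /U -cat_rcons.
  by have := rm_step_at (rcons T (DEC 1 a.+2)) (DEC 2 e) (F ++ [:: DEC 2 0]) R; rewrite size_rcons R2.
have rF x : reach U (a.+2, init_regs x) (a.+2 + size F, init_regs (step x)).
  have := hs x (T ++ [:: DEC 1 a.+2; DEC 2 e]) [:: DEC 2 0].
  by rewrite size_cat /= addn2 -catA.
have s3 R : R 2 = 0 -> rm_step U (a.+2 + size F, R) = (0, R).
  move=> R2; have E1 : (T ++ [:: DEC 1 a.+2, DEC 2 e & F]) ++ [:: DEC 2 0] = U by rewrite -catA.
  have E2 : a.+2 + size F = size (T ++ [:: DEC 1 a.+2, DEC 2 e & F]) by rewrite size_cat /= /a; lia.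
  by rewrite -E1 E2 rm_step_at R2.
have cont x : test x = 0 -> exists k, rm_exec U k.+1 (0, init_regs x) = (0, init_regs (step x)).
  move=> tx; have [k1 E1] := rT x; have [k2 E2] := rF x.
  exists (k2 + k1.+1); rewrite /rm_exec /= -/(rm_exec _ _ _) rm_execD.
  have -> : rm_exec U k1.+1 (0, init_regs x) = (a.+2, init_regs x).
    rewrite /rm_exec /= -/(rm_exec _ _ _) E1 s1 tx /=; congr pair.
    by apply: functional_extensionality => -[|[]].
  by rewrite E2 s3.
exists U => x; split; last first.
  case=> k; elim: k x => [|k IH] x tx.
    have [k1 E1] := rT x; exists k1.+2; rewrite /rm_exec /= -/(rm_exec _ _ _) E1 s1 /=.
    by rewrite {1}/upd /= (introF eqP tx) s2 // sU.
  case: (eqVneq (test x) 0) => [tx0|/eqP tx0]; last first.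
    have [k1 E1] := rT x; exists k1.+2; rewrite /rm_exec /= -/(rm_exec _ _ _) E1 s1 /=.
    by rewrite {1}/upd /= (introF eqP tx0) s2 // sU.
  have [k1 E1] := cont x tx0; have [|k2 E2] := IH (step x); first by rewrite -iterSr.
  by exists (k2 + k1.+1); rewrite rm_execD E1.
move=> hU; apply: NNPP => nh; move: hU; apply: not_rm_halts => k.
have t0 j : test (iter j step x) = 0 by apply: NNPP => h; apply: nh; exists j.
(* If no test succeeds, address 0 is visited at arbitrarily late times. *)
suff [l kl E] : exists2 l, k <= l & rm_exec U l (rm_init x) = (0, init_regs (iter k step x)).
  by exists l => //; rewrite E sU.
elim: k => [|k [l kl E]]; first by exists 0.
have [j Ej] := cont _ (t0 k); exists (j.+1 + l); first by lia.
by rewrite rm_execD E Ej.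
Qed.

(** * Goedel numbering and the universal machine *)

(** Distinct primes, with 2 for register 0 so that the input [n] becomes the Goedel number
    [2 ^ n]. *)
Fixpoint reg_prime (i : nat) : nat :=
  if i is i'.+1 then s2val (prime_above (reg_prime i')) else 2.

Lemma reg_prime_prime i : prime (reg_prime i).
Proof. by case: i => //= i; case: prime_above. Qed.

Lemma reg_prime_gt1 i : 1 < reg_prime i.
Proof. exact/prime_gt1/reg_prime_prime. Qed.

Lemma reg_prime_gt0 i : 0 < reg_prime i.
Proof. exact: ltnW (reg_prime_gt1 i). Qed.

Lemma reg_prime_lt i j : i < j -> reg_prime i < reg_prime j.
Proof.
elim: j => // j IH; rewrite ltnS leq_eqVlt /=; case: prime_above => p /= h _.
by case/orP => [/eqP ->//|/IH /ltn_trans]; apply.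
Qed.

Lemma reg_prime_inj : injective reg_prime.
Proof.
move=> i j E; case: (ltngtP i j) => // /reg_prime_lt; by rewrite E ltnn.
Qed.

Section Goedel.
Variable K : nat.

Definition goedel (R : regs) : nat := \prod_(i < K) reg_prime i ^ R i.

Definition goedel_rest (r : nat) (R : regs) : nat :=
  \prod_(i < K | val i != r) reg_prime i ^ R i.

Lemma goedelE r R : r < K -> goedel R = reg_prime r ^ R r * goedel_rest r R.
Proof. by move=> rK; rewrite /goedel (bigD1 (Ordinal rK)). Qed.

Lemma goedel_rest_upd r R v : goedel_rest r (upd R r v) = goedel_rest r R.
Proof. by apply: eq_bigr => i /negPf ne; rewrite /upd ne. Qed.

Lemma dvd_goedel_rest r R : reg_prime r %| goedel_rest r R = false.
Proof.
apply/negbTE; rewrite /goedel_rest.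
apply: (big_ind (fun x => ~~ (reg_prime r %| x))) => [|x y hx hy|i ir].
- by rewrite dvdn1 gtn_eqF // reg_prime_gt1.
- by rewrite Euclid_dvdM ?reg_prime_prime // negb_or hx.
- rewrite Euclid_dvdX ?reg_prime_prime // dvdn_prime2 ?reg_prime_prime // (inj_eq reg_prime_inj).
  by rewrite eq_sym (negPf ir).
Qed.

Lemma goedel_inc r R : r < K -> goedel (upd R r (R r).+1) = goedel R * reg_prime r.
Proof.
by move=> rK; rewrite !(goedelE _ rK) goedel_rest_upd {1}/upd eqxx expnS -mulnA mulnC.
Qed.

Lemma dvd_goedel r R : r < K -> (reg_prime r %| goedel R) = (R r != 0).
Proof.
move=> rK; rewrite (goedelE _ rK) Euclid_dvdM ?reg_prime_prime // dvd_goedel_rest orbF.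
by rewrite Euclid_dvdX ?reg_prime_prime // dvdnn lt0n.
Qed.

Lemma goedel_dec r R : r < K -> R r != 0 -> goedel (upd R r (R r).-1) = goedel R %/ reg_prime r.
Proof.
move=> rK; rewrite !(goedelE _ rK) goedel_rest_upd /upd eqxx.
by case: (R r) => // n _; rewrite expnS -mulnA mulKn // reg_prime_gt0.
Qed.

Lemma goedel_init n : 0 < K -> goedel (init_regs n) = 2 ^ n.
Proof.
move=> K0; rewrite (goedelE _ K0) /= /goedel_rest big1 ?muln1 // => i /negPf ne.
by rewrite /init_regs ne.
Qed.

Definition instr_reg (i : instr) : nat := match i with INC r => r | DEC r _ => r end.

Definition goedel_step (P : program) (s : nat * nat) : nat * nat :=
  let: (pc, n) := s in
  if size P <= pc then s else
  match nth (INC 0) P pc with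
  | INC r => (pc.+1, n * reg_prime r)
  | DEC r j => if reg_prime r %| n then (pc.+1, n %/ reg_prime r) else (j, n)
  end.

Lemma goedel_stepE P pc R : all (fun i => instr_reg i < K) P ->
  goedel_step P (pc, goedel R) = let: (pc', R') := rm_step P (pc, R) in (pc', goedel R').
Proof.
move=> /all_nthP wf; rewrite /goedel_step /rm_step; case: leqP => // h.
have := wf (INC 0) _ h; case: (nth _ _ _) => [r|r j] /= rK; first by rewrite goedel_inc.
by rewrite dvd_goedel //; case: eqP => //= /eqP ne; rewrite goedel_dec.
Qed.

Lemma goedel_exec P n k : 0 < K -> all (fun i => instr_reg i < K) P ->
  iter k (goedel_step P) (0, 2 ^ n) =
  ((rm_exec P k (rm_init n)).1, goedel (rm_exec P k (rm_init n)).2).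
Proof.
move=> K0 wf; elim: k => [|k IH]; first by rewrite /= -(goedel_init n K0).
rewrite iterS IH goedel_stepE // -surjective_pairing.
by rewrite -[rm_exec P k.+1 _]/(rm_step P (rm_exec P k (rm_init n))); case: (rm_step _ _).
Qed.

End Goedel.

Lemma regs_bound (P : program) : exists2 K, 0 < K & all (fun i => instr_reg i < K) P.
Proof.
elim: P => [|i P [K K0 h]]; first by exists 1.
exists (maxn K (instr_reg i).+1); first by rewrite leq_max K0.
rewrite /= leq_max ltnSn orbT /=; apply: sub_all h => j h; rewrite leq_max h //.
Qed.

Lemma rm_halts_goedel P n :
  rm_halts P n <-> exists k, size P <= (iter k (goedel_step P) (0, 2 ^ n)).1.
Proof.
have [K K0 wf] := regs_bound P.
by split=> -[k hk]; exists k; move: hk; rewrite (goedel_exec n k K0 wf).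
Qed.

(** A [DEC] becomes one rule per residue modulo the prime: residue 0 divides, every other residue
    jumps with the value unchanged. Jump targets are capped at [size P], which thereby becomes the
    single halting state. *)
Definition instr_rules (P : program) (pc : nat) : seq rule :=
  match nth (INC 0) P pc with
  | INC r => [:: Rule pc 1 0 (reg_prime r) 0 pc.+1]
  | DEC r j => Rule pc (reg_prime r) 0 1 0 pc.+1 ::
      [seq Rule pc (reg_prime r) e (reg_prime r) e (minn j (size P)) | e <- iota 1 (reg_prime r).-1]
  end.

Definition program_rules (P : program) : seq rule := flatten (map (instr_rules P) (iota 0 (size P))).

Lemma inlist_nth (T : Type) (x0 x : T) l : inlist x l <-> exists2 i, i < size l & nth x0 l i = x.
Proof.
elim: l => [|y l IH] /=; first by split=> // -[].
rewrite IH; split=> [[->|[i h <-]]|[[|i] /= h <-]].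
- by exists 0.
- by exists i.+1.
- by left.
- by right; exists i.
Qed.

Lemma inlist_map (S T : Type) (f : S -> T) y l : inlist y (map f l) <-> exists2 x, inlist x l & y = f x.
Proof.
elim: l => [|x l IH] /=; first by split=> // -[].
rewrite IH; split=> [[<-|[z h ->]]|[z [->|h] ->]].
- by exists x => //; left.
- by exists z => //; right.
- by left.
- by right; exists z.
Qed.

Lemma program_rulesP P r : inlist r (program_rules P) <-> exists2 pc, pc < size P & inlist r (instr_rules P pc).
Proof.
rewrite inlist_flatten_map; split=> -[pc h1 h2]; exists pc => //.
  by move/inlist_iota: h1.
exact/inlist_iota.
Qed.

Lemma instr_rule_step P pc r k : pc < size P -> inlist r (instr_rules P pc) ->
  [/\ 0 < rule_mod r, rule_src r = pc & exists j,
    goedel_step P (pc, rule_mod r * k + rule_rem r) = (j, rule_mul r * k + rule_add r) /\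
    rule_dst r = minn j (size P)].
Proof.
move=> h; rewrite /instr_rules /goedel_step [size P <= pc]leqNgt h /=; case: (nth _ _ _) => [x|x j].
  by case=> // <- /=; split=> //; exists pc.+1; rewrite (minn_idPl h) mul1n !addn0 mulnC.
have p1 := reg_prime_gt1 x; have p0 := reg_prime_gt0 x.
case=> [<-|/inlist_map [e /inlist_iota he ->]] /=; split=> //.
  by exists pc.+1; rewrite (minn_idPl h) !addn0 dvdn_mulr // mulKn // mul1n.
exists j; split=> //.
have -> : reg_prime x %| reg_prime x * k + e = false; last by [].
by rewrite dvdn_addr ?dvdn_mulr // gtnNdvd //; lia.
Qed.

Lemma step_instr_rule P pc n : pc < size P -> exists r k,
  [/\ inlist r (instr_rules P pc), n = rule_mod r * k + rule_rem r, rule_src r = pc &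
      goedel_step P (pc, n) = goedel_step P (pc, rule_mod r * k + rule_rem r)].
Proof.
move=> h; rewrite /instr_rules; case: (nth _ _ _) => [x|x j].
  by exists (Rule pc 1 0 (reg_prime x) 0 pc.+1), n => /=; split; [left|lia|by []|rewrite mul1n addn0].
have p0 := reg_prime_gt0 x; have E := divn_eq n (reg_prime x); have L := ltn_pmod n p0.
case: (posnP (n %% reg_prime x)) => e0.
  exists (Rule pc (reg_prime x) 0 1 0 pc.+1), (n %/ reg_prime x) => /=.
  have <- : n = reg_prime x * (n %/ reg_prime x) + 0 by rewrite {1}E e0 mulnC.
  by split=> //; left.
exists (Rule pc (reg_prime x) (n %% reg_prime x) (reg_prime x) (n %% reg_prime x) (minn j (size P))), (n %/ reg_prime x) => /=.
have <- : n = reg_prime x * (n %/ reg_prime x) + n %% reg_prime x by rewrite {1}E mulnC.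
split=> //; right; apply/inlist_map; exists (n %% reg_prime x) => //; apply/inlist_iota.
by lia.
Qed.

Lemma program_rules_mod P i : i < size (program_rules P) -> 0 < rule_mod (rule_at (program_rules P) i).
Proof.
move=> h; have : inlist (rule_at (program_rules P) i) (program_rules P).
  by apply/(inlist_nth (Rule 0 0 0 0 0 0)); exists i.
by case/program_rulesP => pc hpc /(instr_rule_step 0 hpc) [].
Qed.

Lemma sim_halts_goedel P pc n : sim_halts (program_rules P) (size P) pc n ->
  exists k, size P <= (iter k (goedel_step P) (pc, n)).1.
Proof.
elim=> {pc n} [n|i k hi _ [l hl]]; first by exists 0.
have : inlist (rule_at (program_rules P) i) (program_rules P).
  by apply/(inlist_nth (Rule 0 0 0 0 0 0)); exists i.
case/program_rulesP => pc hpc /(instr_rule_step k hpc) [_ -> [j [Ej Ed]]].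
move: hl; rewrite Ed; case: (leqP (size P) j) => hj hl.
  by exists 1; rewrite -[iter 1 _ _]/(goedel_step P (pc, _)) Ej.
by exists l.+1; rewrite iterSr Ej.
Qed.

Lemma goedel_sim_halts P pc n k : size P <= (iter k (goedel_step P) (pc, n)).1 ->
  sim_halts (program_rules P) (size P) (minn pc (size P)) n.
Proof.
elim: k pc n => [|k IH] pc n; first by move=> /= h; rewrite (minn_idPr h); apply: sim_done.
case: (leqP (size P) pc) => [h _|h]; first exact: sim_done.
rewrite iterSr; have [r [q [hr En Es Eg]]] := step_instr_rule n h.
have [_ _ [j [Ej Ed]]] := instr_rule_step q h hr.
rewrite Eg Ej => /IH; rewrite -Ed => S.
have /(inlist_nth (Rule 0 0 0 0 0 0)) [i hi Ei] : inlist r (program_rules P).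
  by apply/program_rulesP; exists pc.
have := @sim_step (program_rules P) (size P) i q hi; rewrite /rule_at Ei => /(_ S).
by rewrite Es -En.
Qed.

Lemma rm_halts_sim P n :
  rm_halts P n <-> sim_halts (program_rules P) (size P) 0 (2 ^ n).
Proof.
rewrite rm_halts_goedel; split=> [[k /goedel_sim_halts]|/sim_halts_goedel //].
by rewrite min0n.
Qed.

Definition cneg : code := fun o => [:: DEC 0 o.+3; DEC 0 o.+4; DEC 0 o; INC 0].

Lemma runs_cneg R : R 0 <= 1 -> runs cneg R (upd R 0 (1 - R 0)).
Proof.
move=> R1 pre post; rewrite /cneg /= addn4; set o := size pre; set P := pre ++ _.
have s0 S : rm_step P (o, S) = if S 0 == 0 then (o.+3, S) else (o.+1, upd S 0 (S 0).-1).
  by rewrite /P rm_step_at.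
have s1 S : S 0 = 0 -> rm_step P (o.+1, S) = (o.+4, S).
  move=> S0; rewrite /P -cat_rcons.
  by have := rm_step_at (rcons pre (DEC 0 o.+3)) (DEC 0 o.+4) [:: DEC 0 o, INC 0 & post] S; rewrite size_rcons S0.
have s3 S : rm_step P (o.+3, S) = (o.+4, upd S 0 (S 0).+1).
  have := rm_step_at (pre ++ [:: DEC 0 o.+3; DEC 0 o.+4; DEC 0 o]) (INC 0) post S.
  by rewrite size_cat addn3 -catA.
case E : (R 0) R1 => [|[|n]] // _; exists 2; rewrite -[rm_exec P 2 _]/(rm_step P (rm_step P _)) s0 E.
  by rewrite eqxx s3 E.
by rewrite (_ : (1 == 0) = false) // s1.
Qed.

(** Disjointness of the subsemigroups corresponds to not halting, so a decider for it has to be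
    complemented. *)
Lemma decider_neg D : exists D' : program, forall n,
  (rm_halts_with D n 0 -> rm_halts_with D' n 1) /\ (rm_halts_with D n 1 -> rm_halts_with D' n 0).
Proof.
exists (cseq (creloc D) cneg 0) => n.
have key m : m <= 1 -> rm_halts_with D n m -> rm_halts_with (cseq (creloc D) cneg 0) n (1 - m).
  move=> m1 [k /= [hk Em]].
  have R1 : (rm_exec D k (rm_init n)).2 0 <= 1 by rewrite Em.
  have [l El] := runs_program (runs_seq (runs_creloc hk) (runs_cneg R1)).
  by exists l; rewrite El /=; split=> //; rewrite /upd /= Em.
by split=> /key; apply.
Qed.

Definition code_tail (l : nat) : nat := unpair2 l.-1.
Definition code_drop (i l : nat) : nat := iter_down (fun acc _ => code_tail acc) i l.

(** The prime itself is stored in place of the register index, so that the universal machine need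
    not compute primes. Second component 0 marks [INC], hence the shift of the jump targets. *)
Definition instr_code (i : instr) : nat :=
  match i with
  | INC r => cpair (reg_prime r) 0
  | DEC r j => cpair (reg_prime r) j.+1
  end.

Definition program_code (P : program) : nat := enc_seq instr_code P.

Lemma code_tailE (A : Type) (e : A -> nat) s : code_tail (enc_seq e s) = enc_seq e (behead s).
Proof.
by case: s => [|a s]; rewrite /code_tail /= ?unpair2E // /unpair2 /tri_root big_ord0.
Qed.

Lemma code_dropE (A : Type) (e : A -> nat) i s : code_drop i (enc_seq e s) = enc_seq e (drop i s).
Proof.
elim: i s => [|i IH] s; first by rewrite drop0.
by rewrite -[LHS]/(code_drop i (code_tail (enc_seq e s))) code_tailE IH; case: s.
Qed.

Lemma computable_code_drop : computable2 code_drop.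
Proof.
have := @computable_iter 2 (fun v => nth 0 v 0) (fun v => nth 0 v 1) (fun v => code_tail (nth 0 v 0))
  (@computable_var 2 0 isT) (@computable_var 2 1 isT)
  (computable_app1 computable_unpair2 (computable_pred (@computable_var 4 0 isT))).
exact.
Qed.

Definition state_code (c pc n : nat) : nat := cpair c (cpair pc n).
Definition st_code (z : nat) : nat := unpair1 z.
Definition st_pc (z : nat) : nat := unpair1 (unpair2 z).
Definition st_val (z : nat) : nat := unpair2 (unpair2 z).
(** The code of the instructions from the program counter on; on states of coded programs it is 0
    exactly when the counter has left the program. *)
Definition st_rest (z : nat) : nat := code_drop (st_pc z) (st_code z).
Definition st_instr (z : nat) : nat := unpair1 (st_rest z).-1.
Definition st_prime (z : nat) : nat := unpair1 (st_instr z).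
Definition st_jump (z : nat) : nat := unpair2 (st_instr z).
Definition st_quo (z : nat) : nat := quotient (st_val z) (st_prime z).

Definition universal_step (z : nat) : nat :=
  if st_rest z == 0 then z else
  if st_jump z == 0 then state_code (st_code z) (st_pc z).+1 (st_val z * st_prime z) else
  if st_val z - st_quo z * st_prime z == 0 then state_code (st_code z) (st_pc z).+1 (st_quo z)
  else state_code (st_code z) (st_jump z).-1 (st_val z).

Definition universal_test (z : nat) : nat := if st_rest z == 0 then 1 else 0.

Lemma computable_st : [/\ computable1 st_code, computable1 st_pc, computable1 st_val,
  computable1 st_rest & [/\ computable1 st_prime, computable1 st_jump & computable1 st_quo]].
Proof.
have hc : computable1 st_code := computable_unpair1.
have hp : computable1 st_pc := computable_comp computable_unpair1 computable_unpair2.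
have hv : computable1 st_val := computable_comp computable_unpair2 computable_unpair2.
have hr : computable1 st_rest := computable_app2 computable_code_drop hp hc.
have hi : computable1 st_instr := computable_app1 computable_unpair1 (computable_pred hr).
have hq : computable1 st_prime := computable_app1 computable_unpair1 hi.
split=> //; split=> //; first exact: (computable_app1 computable_unpair2 hi).
exact: (computable_app2 computable_quotient hv hq).
Qed.

Lemma computable_state_code k c p n : computable k c -> computable k p -> computable k n ->
  computable k (fun v => state_code (c v) (p v) (n v)).
Proof.
by move=> hc hp hn; apply: (computable_app2 computable_cpair hc (computable_app2 computable_cpair hp hn)).
Qed.

Lemma computable_universal_step : computable1 universal_step.
Proof.
have [hc hp hv hr [hq hj hu]] := computable_st.
apply: (computable_if hr _ (@computable_var 1 0 isT)).
apply: (computable_if hj); last first.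
  exact: (computable_state_code hc (computable_succ hp) (computable_app2 computable_mul hv hq)).
apply: (computable_if (computable_app2 computable_sub hv (computable_app2 computable_mul hu hq))).
  exact: (computable_state_code hc (computable_pred hj) hv).
exact: (computable_state_code hc (computable_succ hp) hu).
Qed.

Lemma computable_universal_test : computable1 universal_test.
Proof.
have [_ _ _ hr _] := computable_st.
exact: (computable_if hr (computable_zero 1) (computable_const 1 1)).
Qed.

Lemma st_restE P pc n :
  st_rest (state_code (program_code P) pc n) = enc_seq instr_code (drop pc P).
Proof. by rewrite /st_rest /st_pc /st_code /state_code unpair2E !unpair1E code_dropE. Qed.

Lemma st_rest_eq0 P pc n : (st_rest (state_code (program_code P) pc n) == 0) = (size P <= pc).
Proof.
rewrite st_restE; case: leqP => h; first by rewrite drop_oversize.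
by rewrite (drop_nth (INC 0)).
Qed.

Lemma universal_stepE P s :
  universal_step (state_code (program_code P) s.1 s.2) =
  let: (pc, n) := goedel_step P s in state_code (program_code P) pc n.
Proof.
case: s => pc n; rewrite /universal_step st_rest_eq0 /goedel_step /=; case: leqP => // h.
have Ei : st_instr (state_code (program_code P) pc n) = instr_code (nth (INC 0) P pc).
  by rewrite /st_instr st_restE (drop_nth (INC 0)) //= unpair1E.
rewrite /st_quo /st_jump /st_prime Ei /st_val /st_pc /st_code /state_code !unpair2E !unpair1E.
case: (nth _ _ _) => [r|r j] /=; rewrite unpair2E unpair1E //=.
have E2 : n - n %/ reg_prime r * reg_prime r = n %% reg_prime r.
  by rewrite {1}(divn_eq n (reg_prime r)) addKn.
by rewrite quotientE ?reg_prime_gt0 // E2 /dvdn; case: eqP.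
Qed.

Lemma exists_universal : exists U : program, forall P n,
  rm_halts U (state_code (program_code P) 0 (2 ^ n)) <-> rm_halts P n.
Proof.
have [U hU] := program_of_iteration computable_universal_step computable_universal_test.
exists U => P n; rewrite hU rm_halts_goedel.
have E k : iter k universal_step (state_code (program_code P) 0 (2 ^ n)) =
    state_code (program_code P) (iter k (goedel_step P) (0, 2 ^ n)).1 (iter k (goedel_step P) (0, 2 ^ n)).2.
  elim: k => //= k ->; rewrite universal_stepE; by case: goedel_step.
split=> -[k]; rewrite ?E => hk; exists k; move: hk; rewrite ?E /universal_test st_rest_eq0; by case: leqP.
Qed.

(* Kleene's diagonal argument: a program reads its own code as input. *)
Theorem exists_undecidable : exists U : program, forall (g : nat -> nat) (D : program),
  computable1 g ->
  ~ (forall x, (rm_halts U x -> rm_halts_with D (g x) 1) /\ (~ rm_halts U x -> rm_halts_with D (g x) 0)).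
Proof.
have [U hU] := exists_universal; exists U => g D cg hD.
(* [state_code n 0 (2 ^ n)] is the start of the universal machine on the program with code [n] and
   input [n]. *)
pose f n := g (state_code n 0 (2 ^ n)).
have cf : computable1 f.
  apply: (computable_app1 cg); apply: computable_state_code.
  - exact: (@computable_var 1 0 isT).
  - exact: computable_zero.
  - exact: computable_exp2.
have [Q hQ] := decider_flip D cf.
have [h0 h1] := hQ (program_code Q).
have [d1 d0] := hD (state_code (program_code Q) 0 (2 ^ program_code Q)).
case: (classic (rm_halts Q (program_code Q))) => h.
  by apply: (h1 _ h); apply: d1; apply/hU.
by apply: (h); apply: h0; apply: d0 => /hU /h.
Qed.

(** * The reduction *)

Definition enc_prefix (u : word) (m : nat) : nat :=
  foldr (fun a acc => (cpair (enc_letter a) acc).+1) m u.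

Lemma enc_word_cat u w : enc_word (u ++ w) = enc_prefix u (enc_word w).
Proof. exact: foldr_cat. Qed.

Lemma computable_enc_prefix u k f : computable k f -> computable k (fun v => enc_prefix u (f v)).
Proof.
move=> hf; elim: u => //= a u IH.
exact: computable_succ (computable_app2 computable_cpair (computable_const k (enc_letter a)) IH).
Qed.

Lemma enc_word_power u m w :
  enc_word (flatten (nseq m u) ++ w) = iter_down (fun acc _ => enc_prefix u acc) m (enc_word w).
Proof.
have gen n s : iter_down (fun acc _ => enc_prefix u acc) n (enc_prefix u s) =
    enc_prefix u (iter_down (fun acc _ => enc_prefix u acc) n s).
  by elim: n s => //= n IH s; rewrite IH.
by elim: m => //= m IH; rewrite -catA enc_word_cat IH gen.
Qed.

Lemma gen_power_pos g n : gen_pow (g, Posz n) = flatten (nseq n (gen_word g)).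
Proof. by []. Qed.

Lemma gen_power_neg g n : gen_pow (g, (- Posz n)%R) = flatten (nseq n (winv (gen_word g))).
Proof. by case: n. Qed.

Lemma start_wordE N : start_word N = content_word (key_content Start) ++
  flatten (nseq (6 * N) (gen_word GC)) ++ content_word (content_inv (key_content (Main 0))).
Proof.
rewrite /start_word /arrow_word /arrow_content !content_word_cat content_word1.
by rewrite -gen_power_pos (_ : Posz (6 * N) = (6 * Posz N)%R) //; lia.
Qed.

Lemma target_wordE N : target_word N = content_word (key_content (Main 0)) ++
  flatten (nseq (6 * N) (winv (gen_word GC))) ++ [::].
Proof.
rewrite /target_word content_word_cat content_word1 cats0.
by rewrite -gen_power_neg (_ : Posz (6 * N) = (6 * Posz N)%R) //; lia.
Qed.

(** In all instances of the reduction only one block, repeated [6 * 2 ^ x] times in a single word,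
    depends on [x], so this makes the encodings of the instances computable. *)
Lemma computable_enc_power (u w v : word) :
  computable1 (fun x => enc_word (u ++ flatten (nseq (6 * 2 ^ x) w) ++ v)).
Proof.
have hN : computable1 (fun x => 6 * 2 ^ x).
  exact: (computable_app2 computable_mul (computable_const 1 6) computable_exp2).
have hs : computable 3 (fun y => enc_prefix w (nth 0 y 0)).
  exact: (computable_enc_prefix w (@computable_var 3 0 isT)).
have h := computable_iter hN (computable_const 1 (enc_word v)) hs.
have := computable_enc_prefix u h; apply: computable_ext => y _.
by rewrite enc_word_cat enc_word_power.
Qed.

Section Undecidability.
Variable U : program.

Let X0 : seq word := arrow_words (program_rules U) (size U).
Let X (x : nat) : seq word := start_word (2 ^ x) :: X0.

Lemma product_halts x k ws : all (fun y => y \in X x) ws ->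
  beq (flatten ws) (flatten (nseq k.+1 gamma0)) -> rm_halts U x.
Proof.
move=> h B; apply/rm_halts_sim; apply: (product_sim_halts _ h B) => i.
exact: program_rules_mod.
Qed.

Lemma inMon_target x : inMon X0 (target_word (2 ^ x)) <-> rm_halts U x.
Proof.
split=> [[ws [h B]]|/rm_halts_sim/sim_halts_product [ws h B]].
  apply: (@product_halts x 0 (start_word (2 ^ x) :: ws)).
    rewrite /= mem_head /=; apply: sub_all h => y h; by rewrite in_cons h orbT.
  exact: (beq_trans (beq_cat (beq_refl (start_word (2 ^ x))) B) (start_target _)).
exists ws; split=> //; apply: (@beq_cancel_l (start_word (2 ^ x))).
by rewrite B; apply/beq_sym/start_target.
Qed.

Lemma inSgp_gamma0 x : rm_halts U x -> inSgp (X x) gamma0.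
Proof.
move=> /rm_halts_sim/sim_halts_product [ws h B].
exists (start_word (2 ^ x) :: ws); split=> //; split=> //.
rewrite /= mem_head /=; apply: sub_all h => y h; by rewrite in_cons h orbT.
Qed.

Lemma inMon_gamma0 x : inMon (X x) gamma0 <-> rm_halts U x.
Proof.
split=> [[ws [h B]]|/inSgp_gamma0 [ws [_ h]]]; last by exists ws.
exact: (@product_halts x 0 ws h B).
Qed.

Lemma sgp_disjoint_gamma0 x : sgp_disjoint (X x) [:: gamma0] <-> ~ rm_halts U x.
Proof.
split=> [dis /inSgp_gamma0 h|nh [w [[ws [_ [h B]]] [[|g gs] [// _ [hg Bg]]]]]].
  apply: dis; exists gamma0; split=> //; exists [:: gamma0]; split=> //.
  by split; [rewrite /all mem_head|exact: beq_refl].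
apply: nh; apply: (@product_halts x (size gs) ws h).
(* A nonempty product over the one generator [gamma0] is a positive power of it, which is why
   soundness is stated for the exponents [k.+1]. *)
have -> : flatten (nseq (size gs).+1 gamma0) = flatten (g :: gs).
  congr flatten; apply/esym/(all_pred1P gamma0 (g :: gs)).
  by apply: sub_all hg => y; rewrite inE.
exact: (beq_trans B (beq_sym Bg)).
Qed.

End Undecidability.

Theorem mainTheorem4 :
  (* (i) a fixed finite X with undecidable membership in Mon(X) ... *)
  ((exists X : seq word, ~ RM_decidable enc_word (inMon X)) /\
   (* ... in particular the uniform submonoid membership problem *)
   ~ RM_decidable enc_words_word (fun p => inMon p.1 p.2)) /\
  (* (ii) gamma0 \in Mon(X), X given *)
  ~ RM_decidable enc_words (fun X => inMon X gamma0) /\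
  (* (iii) Sgp(X) \cap Sgp(gamma0) = empty, X given ... *)
  (~ RM_decidable enc_words (fun X => sgp_disjoint X [:: gamma0]) /\
   (* ... in particular the subsemigroup intersection problem *)
   ~ RM_decidable enc_words_words (fun p => sgp_disjoint p.1 p.2)).
Proof.
have [U undec] := exists_undecidable.
pose X0 := arrow_words (program_rules U) (size U).
pose X x := start_word (2 ^ x) :: X0.
have ct : computable1 (fun x => enc_word (target_word (2 ^ x))).
  have := computable_enc_power (content_word (key_content (Main 0))) (winv (gen_word GC)) [::].
  by apply: computable1_ext => x; rewrite target_wordE.
have cX : computable1 (fun x => enc_words (X x)).
  have := computable_enc_power (content_word (key_content Start)) (gen_word GC)
    (content_word (content_inv (key_content (Main 0)))).
  move=> h; apply: computable_ext (computable_succ (computable_app2 computable_cpair h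
    (computable_const 1 (enc_words X0)))) => v _.
  by rewrite -start_wordE.
split; [split|split; [|split]].
- exists X0 => -[D hD]; apply: (undec _ D ct) => x.
  by have [h1 h0] := hD (target_word (2 ^ x)); split=> [/inMon_target/h1|nh]; last by apply: h0 => /inMon_target.
- case=> D hD; apply: (undec (fun x => enc_words_word (X0, target_word (2 ^ x))) D) => [|x].
    exact: (computable_app2 computable_cpair (computable_const 1 (enc_words X0)) ct).
  by have [h1 h0] := hD (X0, target_word (2 ^ x)); split=> [/inMon_target/h1|nh]; last by apply: h0 => /inMon_target.
- case=> D hD; apply: (undec _ D cX) => x.
  by have [h1 h0] := hD (X x); split=> [/inMon_gamma0/h1|nh]; last by apply: h0 => /inMon_gamma0.
- case=> D hD; have [D' hD'] := decider_neg D; apply: (undec _ D' cX) => x.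
  have [h1 h0] := hD (X x); have [n0 n1] := hD' (enc_words (X x)).
  by split=> [h|/sgp_disjoint_gamma0/h1/n1 //]; apply/n0/h0 => /sgp_disjoint_gamma0.
- case=> D hD; have [D' hD'] := decider_neg D.
  apply: (undec (fun x => enc_words_words (X x, [:: gamma0])) D') => [|x].
    exact: (computable_app2 computable_cpair cX (computable_const 1 (enc_words [:: gamma0]))).
  have [h1 h0] := hD (X x, [:: gamma0]); have [n0 n1] := hD' (enc_words_words (X x, [:: gamma0])).
  by split=> [h|/sgp_disjoint_gamma0/h1/n1 //]; apply/n0/h0 => /sgp_disjoint_gamma0.
Qed.
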